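(* Every exact curved Courant algebroid over $M$ is isomorphic to $(TM\oplus T^*M,\langle\,,\rangle_+,\mathrm{pr}_{TM},[\,,]^{T}_{H})$ for some $T\in\Omega^2(M,TM)$ and $H\in\Omega^3(M)$.
   Context: Everything is smooth. A tuple $(\mathbb{E},\langle\,,\rangle,\rho,[\,,])$ over $M$ consists of a vector bundle $\mathbb{E}\to M$, a non-degenerate symmetric pairing, a vector bundle morphism $\rho:\mathbb{E}\to TM$ over $\mathrm{id}_M$, and an $\mathbb{R}$-bilinear bracket on $\Gamma(\mathbb{E})$. Define $\rho^*:T^*M\to\mathbb{E}$ by $\langle\rho^*\alpha,b\rangle=\alpha(\rho(b))$. A metric algebroid is a tuple with $[a,b]+[b,a]=\rho^*d\langle a,b\rangle$ and $\rho(a)\langle b,c\rangle=\langle[a,b],c\rangle+\langle b,[a,c]\rangle$. It is a curved Courant algebroid if $F(a,b):=\rho([a,b])-[\rho(a),\rho(b)]_{\mathrm{Lie}}$ satisfies $F\in\Gamma(\wedge^2\mathbb{E}^*\otimes TM)$ and $F(a,b)=0$ whenever $a\in\ker\rho$ (pointwise). It is exact if $0\to T^*M\xrightarrow{\rho^*}\mathbb{E}\xrightarrow{\rho}TM\to0$ is exact. An isomorphism of metric algebroids over $M$ is a vector bundle isomorphism $\phi:\mathbb{E}\to\mathbb{E}'$ over the identity with $\langle\phi a,\phi b\rangle'=\langle a,b\rangle$, $\rho'\circ\phi=\rho$, $[\phi a,\phi b]'=\phi[a,b]$. For $T\in\Omega^2(M,TM)$: $\iota_T$ is the unique degree-$1$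 graded derivation of $\Omega^\bullet(M)$ with $\iota_Tf=0$ on functions and $(\iota_T\alpha)(X,Y)=\alpha(T(X,Y))$ on $1$-forms; $d^{T}:=d-\iota_T$; $L^{T}_X:=\iota_X d^{T}+d^{T}\iota_X$; $[X,Y]^{T}:=[X,Y]_{\mathrm{Lie}}+T(X,Y)$. On $TM\oplus T^*M$, $\langle X+\alpha,Y+\beta\rangle_+:=\alpha(Y)+\beta(X)$ and, for $H\in\Omega^3(M)$, $$[X+\alpha,Y+\beta]^{T}_{H}:=[X,Y]^{T}+L^{T}_X\beta-\iota_Yd^{T}\alpha+\iota_Y\iota_XH.$$ *)

(* Defs.v *)
From HB Require Import structures.
From mathcomp Require Import all_boot all_order all_algebra.
From mathcomp Require Import all_classical all_reals all_analysis.
From mathcomp Require Import ring.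

Set Implicit Arguments.
Unset Strict Implicit.
Unset Printing Implicit Defensive.

Import Order.TTheory GRing.Theory Num.Theory.
Import numFieldNormedType.Exports.

Local Open Scope classical_set_scope.
Local Open Scope ring_scope.

Section SmoothRn.
Variables (R : realType) (n : nat).
Implicit Types (U : set 'rV[R]_n) (f g : 'rV[R]_n -> R).

(* Meant for open U: continuity and partial derivatives are taken in the
   ambient space. *)
Fixpoint Ck (k : nat) U f : Prop :=
  (forall x, U x -> {for x, continuous f}) /\
  (if k is k'.+1 then
     forall i : 'I_n, (forall x, U x -> derivable f x 'e_i) /\
                      Ck k' U ('D_'e_i f)
   else True).

Definition Csmooth U f : Prop := forall k, Ck k U f.

Lemma Ck_cont k U f x : Ck k U f -> U x -> {for x, continuous f}.
Proof. by case: k => [|k] [fc _]; apply: fc. Qed.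

Lemma CkS k U f : Ck k.+1 U f -> Ck k U f.
Proof.
elim: k f => [|k IH] f [fc fd]; first by split.
by split=> // i; have [di ci] := fd i; split=> //; apply: IH.
Qed.

Lemma Ck_ext k U f g : open U -> (forall x, U x -> f x = g x) ->
  Ck k U f -> Ck k U g.
Proof.
move=> oU; move: f g.
have nfg f g x : (forall x, U x -> f x = g x) -> U x -> {near x, f =1 g}.
  by move=> fg Ux; apply: filterS (open_nbhs_nbhs (conj oU Ux)) => y /fg.
elim: k => [|k IH] f g fg [fc fd]; split=> //.
- move=> x Ux; rewrite /prop_for /continuous_at -fg//.
  exact: cvg_trans (near_eq_cvg (nfg _ _ _ fg Ux)) (fc x Ux).
- move=> x Ux; rewrite /prop_for /continuous_at -fg//.
  exact: cvg_trans (near_eq_cvg (nfg _ _ _ fg Ux)) (fc x Ux).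
move=> i; have [di ci] := fd i.
split=> [x Ux|].
  exact: near_eq_derivable (nfg _ _ _ fg Ux) (di x Ux).
apply: IH ci => x Ux; exact: near_eq_derive (nfg _ _ _ fg Ux).
Qed.

Lemma Ck_cst k U (c : R) : Ck k U (fun=> c).
Proof.
elim: k c => [|k IH] c; first by split=> // x _; exact: cst_continuous.
split=> [x _|i]; first exact: cst_continuous.
split=> [x _|]; first exact: derivable_cst.
have -> : 'D_'e_i (fun=> c) = (fun=> 0) :> ('rV[R]_n -> R).
  by apply: funext => x; exact: derive_cst.
exact: IH.
Qed.

Lemma CkD k U f g : open U -> Ck k U f -> Ck k U g ->
  Ck k U (fun x => f x + g x).
Proof.
move=> oU; elim: k f g => [|k IH] f g [fc fd] [gc gd].
  by split=> // x Ux; apply: continuousD; [exact: fc|exact: gc].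
split=> [x Ux|i]; first by apply: continuousD; [exact: fc|exact: gc].
have [fi fci] := fd i; have [gi gci] := gd i; split=> [x Ux|].
  by apply: derivableD; [exact: fi|exact: gi].
apply: Ck_ext (IH _ _ fci gci) => // x Ux.
by apply/esym/deriveD; [exact: fi|exact: gi].
Qed.

Lemma CkM k U f g : open U -> Ck k U f -> Ck k U g ->
  Ck k U (fun x => f x * g x).
Proof.
move=> oU; elim: k f g => [|k IH] f g Cf Cg.
  split=> // x Ux; apply: continuousM;
    [exact: Ck_cont Cf Ux|exact: Ck_cont Cg Ux].
split=> [x Ux|i].
  apply: continuousM; [exact: Ck_cont Cf Ux|exact: Ck_cont Cg Ux].
have [fi fci] := Cf.2 i; have [gi gci] := Cg.2 i; split=> [x Ux|].
  by apply: derivableM; [exact: fi|exact: gi].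
apply: Ck_ext (CkD oU (IH _ _ (CkS Cf) gci) (IH _ _ (CkS Cg) fci)) => // x Ux.
by apply/esym/deriveM; [exact: fi|exact: gi].
Qed.

End SmoothRn.

(* A smooth n-manifold, presented by an atlas: a Hausdorff second countable
   space whose charts are homeomorphisms from open sets onto open subsets of
   R^n (continuous, injective, open maps), with smooth transition maps. *)
Record manifold (R : realType) (n : nat) := Manifold {
  carrier :> topologicalType;
  manifold_hausdorff : hausdorff_space carrier;
  manifold_second_countable : @second_countable carrier;
  atlas : Type;
  dom : atlas -> set carrier;
  chart : atlas -> carrier -> 'rV[R]_n;
  dom_open : forall i, open (dom i);
  dom_cover : forall p, exists i, dom i p;
  chart_continuous : forall i p, dom i p -> {for p, continuous (chart i)};
  chart_inj : forall i p q, dom i p -> dom i q ->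
    chart i p = chart i q -> p = q;
  chart_open : forall i (V : set carrier), open V -> V `<=` dom i ->
    open (chart i @` V);
  chart_transition : forall i j, exists tau : 'rV[R]_n -> 'rV[R]_n,
    (forall a, Csmooth (chart i @` (dom i `&` dom j)) (fun x => tau x 0 a)) /\
    (forall p, dom i p -> dom j p -> chart j p = tau (chart i p)) }.

Section SmoothFunctions.
Variables (R : realType) (n : nat) (M : manifold R n).
Implicit Types (U : set M) (f g : M -> R).

(* Meant for open U. *)
Definition smooth_on U f : Prop := forall i : atlas M,
  exists2 F : 'rV[R]_n -> R, Csmooth (chart i @` (U `&` dom i)) F &
    forall p, U p -> dom i p -> f p = F (chart i p).

Lemma open_chartI U i : open U -> open (chart i @` (U `&` dom i)).
Proof.
move=> oU; apply: chart_open; last exact: subIsetr.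
by apply: openI => //; exact: dom_open.
Qed.

Lemma smooth_on_cst U (c : R) : smooth_on U (fun=> c).
Proof. by move=> i; exists (fun=> c) => // k; exact: Ck_cst. Qed.

Lemma smooth_onD U f g : open U -> smooth_on U f -> smooth_on U g ->
  smooth_on U (fun p => f p + g p).
Proof.
move=> oU sf sg i; have [F sF fF] := sf i; have [G sG gG] := sg i.
exists (fun x => F x + G x) => [k|p Up ip]; last by rewrite fF ?gG.
by apply: CkD; [exact: open_chartI|exact: sF|exact: sG].
Qed.

Lemma smooth_onM U f g : open U -> smooth_on U f -> smooth_on U g ->
  smooth_on U (fun p => f p * g p).
Proof.
move=> oU sf sg i; have [F sF fF] := sf i; have [G sG gG] := sg i.
exists (fun x => F x * G x) => [k|p Up ip]; last by rewrite fF ?gG.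
by apply: CkM; [exact: open_chartI|exact: sF|exact: sG].
Qed.

Definition smooth_fun : {pred M -> R} := fun f => `[< smooth_on setT f >].

Lemma smooth_funP f : reflect (smooth_on setT f) (f \in smooth_fun).
Proof. exact: asboolP. Qed.

Lemma smooth_fun_subring : subring_closed smooth_fun.
Proof.
have sN f : f \in smooth_fun -> - f \in smooth_fun.
  move=> /smooth_funP sf; apply/smooth_funP.
  have -> : - f = (fun p => -1 * f p) by apply/funext => p; rewrite mulN1r.
  by apply: smooth_onM => //; [exact: openT|exact: smooth_on_cst].
split=> [|f g sf /sN sg|f g /smooth_funP sf /smooth_funP sg].
- by apply/smooth_funP; exact: smooth_on_cst.
- apply/smooth_funP; move: sf sg => /smooth_funP sf /smooth_funP sg.
  by apply: smooth_onD => //; exact: openT.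
- by apply/smooth_funP; apply: smooth_onM => //; exact: openT.
Qed.

Lemma smooth_fun_scale : GRing.scaler_closed smooth_fun.
Proof.
move=> k f /smooth_funP sf; apply/smooth_funP.
by apply: smooth_onM => //; [exact: openT|exact: smooth_on_cst].
Qed.

HB.instance Definition _ :=
  GRing.isSubringClosed.Build (M -> R) smooth_fun smooth_fun_subring.
HB.instance Definition _ :=
  GRing.isScaleClosed.Build R (M -> R) smooth_fun smooth_fun_scale.

(* The algebra of smooth functions on M. *)
Record Cinf := MkCinf { Cinf_val :> M -> R; _ : Cinf_val \in smooth_fun }.

HB.instance Definition _ := [isSub for Cinf_val].
HB.instance Definition _ := [Choice of Cinf by <:].
HB.instance Definition _ := 
  GRing.SubChoice_isSubComPzRing.Build _ _ Cinf (subringClosedP _).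
HB.instance Definition _ := [SubZmodule_isSubLmodule of Cinf by <:].

Definition mkCinf f (sf : smooth_on setT f) : Cinf :=
  MkCinf (introT (smooth_funP f) sf).

Lemma Cinf_smooth (f : Cinf) : smooth_on setT f.
Proof. by apply/smooth_funP; case: f. Qed.

End SmoothFunctions.

(* Tangent vectors at p are the derivations of Cinf M at p; cotangent vectors
   are the linear forms on them. *)
Section Tangent.
Variables (R : realType) (n : nat) (M : manifold R n) (p : M).

Definition derivation_at : {pred Cinf M -> R^o} := fun v =>
  `[< linear v /\ forall f g : Cinf M, v (f * g) = f p * v g + g p * v f >].

Lemma derivation_at_submod : submod_closed derivation_at.
Proof.
split=> [|k v w /asboolP[vl vd] /asboolP[wl wd]]; apply/asboolP; split.
- by move=> a f g; apply/esym/(etrans (addr0 _))/scaler0.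
- by move=> f g; apply/esym/(etrans (congr2 +%R (mulr0 _) (mulr0 _)))/addr0.
- move=> a f g; rewrite /= !fctE vl wl /GRing.scale /=; ring.
- move=> f g; rewrite !fctE vd wd /GRing.scale /=; ring.
Qed.

HB.instance Definition _ := GRing.isSubmodClosed.Build R (Cinf M -> R^o)
  derivation_at derivation_at_submod.

Record tangent := MkTangent
  { tangent_val :> Cinf M -> R^o; _ : tangent_val \in derivation_at }.

HB.instance Definition _ := [isSub for tangent_val].
HB.instance Definition _ := [Choice of tangent by <:].
HB.instance Definition _ := [SubChoice_isSubLmodule of tangent by <:].

Definition linear_form_on_tangent : {pred tangent -> R^o} := fun a =>
  `[< linear a >].

Lemma linear_form_submod : submod_closed linear_form_on_tangent.
Proof.
split=> [|k v w /asboolP vl /asboolP wl]; apply/asboolP.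
- by move=> a f g; apply/esym/(etrans (addr0 _))/scaler0.
- move=> a f g; rewrite /= !fctE vl wl /GRing.scale /=; ring.
Qed.

HB.instance Definition _ := GRing.isSubmodClosed.Build R (tangent -> R^o)
  linear_form_on_tangent linear_form_submod.

Record cotangent := MkCotangent
  { cotangent_val :> tangent -> R^o;
    _ : cotangent_val \in linear_form_on_tangent }.

HB.instance Definition _ := [isSub for cotangent_val].
HB.instance Definition _ := [Choice of cotangent by <:].
HB.instance Definition _ := [SubChoice_isSubLmodule of cotangent by <:].

Lemma tangent_linear (v : tangent) : linear v.
Proof. by case: v => v /= /asboolP[]. Qed.

Lemma tangent_leibniz (v : tangent) f g : v (f * g) = f p * v g + g p * v f.
Proof. by case: v => v /= /asboolP[]. Qed.

Lemma cotangent_linear (al : cotangent) : linear al.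
Proof. by case: al => al /= /asboolP. Qed.

Lemma cotangent0 (al : cotangent) : al 0 = 0.
Proof.
by have := cotangent_linear al (-1) 0 0; rewrite scaler0 addr0 scaleN1r addNr.
Qed.

End Tangent.

(* A family of vector spaces over M together with a set of sections called
   smooth, stable under combinations with smooth coefficients. The vector
   bundles are singled out by is_vector_bundle. *)
Record bundle (R : realType) (n : nat) (M : manifold R n) := Bundle {
  fiber :> M -> lmodType R;
  smooth_section : (forall p, fiber p) -> Prop;
  smooth_section0 : smooth_section (fun=> 0);
  smooth_sectionP : forall (f : Cinf M) s t,
    smooth_section s -> smooth_section t ->
    smooth_section (fun p => f p *: s p + t p) }.

(* E is a smooth vector bundle of rank r: it has local trivializations with
   smooth transition functions, and its smooth sections are those with smooth
   coordinates in them. *)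
Definition is_vector_bundle_of_rank (R : realType) (n : nat)
    (M : manifold R n) (E : bundle M) (r : nat) : Prop :=
  exists (J : Type) (U : J -> set M)
    (triv : J -> forall p, {linear E p -> 'rV[R]_r}),
  [/\ forall j, open (U j),
      forall p, exists j, U j p,
      forall j p, U j p -> bijective (triv j p),
      forall j k, exists2 g : M -> 'M[R]_r,
        forall a b, smooth_on (U j `&` U k) (fun p => g p a b) &
        forall p, U j p -> U k p ->
          forall e : E p, triv k p e = triv j p e *m g p
    & forall s : forall p, E p,
        smooth_section s <->
        forall j a, smooth_on (U j) (fun p => triv j p (s p) 0 a)].

Definition is_vector_bundle (R : realType) (n : nat) (M : manifold R n)
    (E : bundle M) : Prop :=
  exists r, is_vector_bundle_of_rank E r.

(* The space Gamma(E) of smooth sections. *)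
Section Gamma.
Variables (R : realType) (n : nat) (M : manifold R n) (E : bundle M).

Record Gamma := MkGamma
  { section :> forall p, E p; section_smooth : smooth_section section }.

Lemma GammaP (a b : Gamma) : (forall p, a p = b p) -> a = b.
Proof.
case: a b => [a sa] [b sb] /= ab; have {}ab : a = b.
  exact: functional_extensionality_dep.
by rewrite -{b}ab in sb *; congr MkGamma; exact: Prop_irrelevance.
Qed.

HB.instance Definition _ := gen_eqMixin Gamma.
HB.instance Definition _ := gen_choiceMixin Gamma.

Definition Gamma0 : Gamma := MkGamma (smooth_section0 E).

Definition scaleGamma_add (f : Cinf M) (a b : Gamma) : Gamma :=
  MkGamma (smooth_sectionP f (section_smooth a) (section_smooth b)).

Definition constC (k : R) : Cinf M := mkCinf (smooth_on_cst setT k).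

Definition addGamma := scaleGamma_add (constC 1).
Definition scaleGamma k a := scaleGamma_add (constC k) a Gamma0.
Definition oppGamma := scaleGamma (- 1).

Lemma addGammaE a b p : addGamma a b p = a p + b p.
Proof. by rewrite /= scale1r. Qed.

Lemma scaleGammaE k a p : scaleGamma k a p = k *: a p.
Proof. by rewrite /= addr0. Qed.

Lemma oppGammaE a p : oppGamma a p = - a p.
Proof. by rewrite scaleGammaE scaleN1r. Qed.

Fact addGammaA : associative addGamma.
Proof. by move=> a b c; apply: GammaP => p; rewrite !addGammaE addrA. Qed.
Fact addGammaC : commutative addGamma.
Proof. by move=> a b; apply: GammaP => p; rewrite !addGammaE addrC. Qed.
Fact add0Gamma : left_id Gamma0 addGamma.
Proof. by move=> a; apply: GammaP => p; rewrite addGammaE add0r. Qed.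
Fact addNGamma : left_inverse Gamma0 oppGamma addGamma.
Proof. by move=> a; apply: GammaP => p; rewrite addGammaE oppGammaE addNr. Qed.

HB.instance Definition _ :=
  GRing.isZmodule.Build Gamma addGammaA addGammaC add0Gamma addNGamma.

Fact scaleGammaA k l a : scaleGamma k (scaleGamma l a) = scaleGamma (k * l) a.
Proof. by apply: GammaP => p; rewrite !scaleGammaE scalerA. Qed.
Fact scale1Gamma : left_id 1 scaleGamma.
Proof. by move=> a; apply: GammaP => p; rewrite scaleGammaE scale1r. Qed.
Fact scaleGammaDr : right_distributive scaleGamma addGamma.
Proof.
by move=> k a b; apply: GammaP => p; rewrite !(addGammaE, scaleGammaE) scalerDr.
Qed.
Fact scaleGammaDl a : {morph scaleGamma^~ a : k l / k + l >-> addGamma k l}.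
Proof.
by move=> k l; apply: GammaP => p; rewrite !(addGammaE, scaleGammaE) scalerDl.
Qed.

HB.instance Definition _ := GRing.Zmodule_isLmodule.Build R Gamma
  scaleGammaA scale1Gamma scaleGammaDr scaleGammaDl.

Lemma GammaDE (a b : Gamma) p : (a + b) p = a p + b p.
Proof. exact: addGammaE. Qed.
Lemma GammaNE (a : Gamma) p : (- a) p = - a p.
Proof. exact: oppGammaE. Qed.
Lemma GammaZE k (a : Gamma) p : (k *: a) p = k *: a p.
Proof. exact: scaleGammaE. Qed.

End Gamma.

(* A vector bundle morphism over the identity. A fibrewise linear map between
   vector bundles is smooth iff it sends smooth sections to smooth sections. *)
Section BundleMorphism.
Variables (R : realType) (n : nat) (M : manifold R n).

Record bundle_morphism (E F : bundle M) := BundleMorphism {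
  bmor :> forall p, {linear E p -> F p};
  bmor_smooth : forall a : Gamma E, smooth_section (fun p => bmor p (a p)) }.

Definition push (E F : bundle M) (phi : bundle_morphism E F) (a : Gamma E) :
  Gamma F := MkGamma (bmor_smooth phi a).

Definition is_bundle_isomorphism (E F : bundle M)
    (phi : bundle_morphism E F) : Prop :=
  exists psi : bundle_morphism F E,
    forall p, cancel (phi p) (psi p) /\ cancel (psi p) (phi p).

Lemma line_smoothP (f : Cinf M) (s t : M -> R^o) :
  smooth_on setT s -> smooth_on setT t ->
  smooth_on setT (fun p => f p *: s p + t p).
Proof.
move=> ss st; apply: smooth_onD => //; first exact: openT.
by apply: smooth_onM => //; [exact: openT|exact: Cinf_smooth].
Qed.

(* The trivial line bundle, with sections the smooth functions. *)
Definition line : bundle M := Bundle (smooth_on_cst setT 0) line_smoothP.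

End BundleMorphism.
Arguments line {R n} M.

(* The tangent and cotangent bundles. As in O'Neill's Semi-Riemannian Geometry,
   a vector field X is smooth when Xf is smooth for every smooth function f, a
   1-form is smooth when it takes smooth vector fields to smooth functions, and
   likewise for the tensor fields below. *)
Section TangentBundle.
Variables (R : realType) (n : nat) (M : manifold R n).

Definition smooth_vf (X : forall p : M, tangent p) : Prop :=
  forall f : Cinf M, smooth_on setT (fun p => X p f).

Fact smooth_vf0 : smooth_vf (fun=> 0).
Proof. by move=> f; exact: smooth_on_cst. Qed.

Fact smooth_vfP (f : Cinf M) X Y : smooth_vf X -> smooth_vf Y ->
  smooth_vf (fun p => f p *: X p + Y p).
Proof. by move=> sX sY g; exact: (line_smoothP f (sX g) (sY g)). Qed.

Definition TM : bundle M := Bundle smooth_vf0 smooth_vfP.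

Definition smooth_form (al : forall p : M, cotangent p) : Prop :=
  forall X : Gamma TM, smooth_on setT (fun p => al p (X p)).

Fact smooth_form0 : smooth_form (fun=> 0).
Proof. by move=> f; exact: smooth_on_cst. Qed.

Fact smooth_formP (f : Cinf M) al be : smooth_form al -> smooth_form be ->
  smooth_form (fun p => f p *: al p + be p).
Proof. by move=> sa sb X; exact: (line_smoothP f (sa X) (sb X)). Qed.

Definition TstarM : bundle M := Bundle smooth_form0 smooth_formP.

Section DirectSum.
Variables (E F : bundle M).

Definition smooth_sum (s : forall p, (E p * F p)%type) : Prop :=
  smooth_section (fun p => (s p).1) /\ smooth_section (fun p => (s p).2).

Fact smooth_sum0 : smooth_sum (fun=> 0).
Proof. by split; exact: smooth_section0. Qed.

Fact smooth_sumP (f : Cinf M) s t : smooth_sum s -> smooth_sum t ->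
  smooth_sum (fun p => f p *: s p + t p).
Proof. by move=> [s1 s2] [t1 t2]; split; exact: smooth_sectionP. Qed.

Definition dsum : bundle M := Bundle smooth_sum0 smooth_sumP.

Definition dsum1 (s : Gamma dsum) : Gamma E := MkGamma (section_smooth s).1.
Definition dsum2 (s : Gamma dsum) : Gamma F := MkGamma (section_smooth s).2.

Fact pair_smooth (a : Gamma E) (b : Gamma F) :
  smooth_sum (fun p => (a p, b p)).
Proof. by split; exact: section_smooth. Qed.

Definition dsum_pair (a : Gamma E) (b : Gamma F) : Gamma dsum :=
  MkGamma (pair_smooth a b : @smooth_section _ _ _ dsum _).

End DirectSum.

End TangentBundle.
Arguments TM {R n} M.
Arguments TstarM {R n} M.

Section VectorFields.
Variables (R : realType) (n : nat) (M : manifold R n).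
Implicit Types (X Y Z : Gamma (TM M)) (f g : Cinf M) (al be : Gamma (TstarM M)).

(* Xf *)
Definition act X f : Cinf M := mkCinf (section_smooth X f).

(* al(X) *)
Definition pairing1 al X : Cinf M := mkCinf (section_smooth al X).

Fact lie_derivation X Y p :
  (fun f => X p (act Y f) - Y p (act X f)) \in derivation_at p.
Proof.
have actL Z k g h : act Z (k *: g + h) = k *: act Z g + act Z h.
  by apply/val_inj/funext => q; exact: tangent_linear.
have actM Z g h : act Z (g * h) = g * act Z h + h * act Z g.
  by apply/val_inj/funext => q; exact: tangent_leibniz.
apply/asboolP; split => [k g h|g h].
  by rewrite !actL !tangent_linear /GRing.scale /=; ring.
have lD Z g1 h1 : Z p (g1 + h1) = Z p g1 + Z p h1.
  by have := tangent_linear (Z p) 1 g1 h1; rewrite !scale1r.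
by rewrite !actM !lD !tangent_leibniz /=; ring.
Qed.

Definition lie_at X Y p : tangent p := MkTangent (lie_derivation X Y p).

Fact lie_smooth X Y f : smooth_on setT (fun p => lie_at X Y p f).
Proof. exact: Cinf_smooth (act X (act Y f) - act Y (act X f)). Qed.

Definition lie X Y : Gamma (TM M) :=
  MkGamma (lie_smooth X Y : @smooth_section _ _ _ (TM M) _).

Fact differential_linear f p :
  (fun v : tangent p => v f) \in @linear_form_on_tangent _ _ _ p.
Proof. by apply/asboolP. Qed.

Definition differential_at f p : cotangent p :=
  MkCotangent (differential_linear f p).

Fact differential_smooth f :
  @smooth_section _ _ _ (TstarM M) (differential_at f).
Proof. by move=> X; exact: (section_smooth X f). Qed.

(* df *)
Definition d0 f : Gamma (TstarM M) := MkGamma (differential_smooth f).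

End VectorFields.

(* Sections of Lambda^2 E^* (x) F. For E = TM these are the 2-forms on M with
   values in F. *)
Section Forms2.
Variables (R : realType) (n : nat) (M : manifold R n).

Record form2 (E F : bundle M) := Form2 {
  form2_val :> forall p, E p -> E p -> F p;
  form2_linearl : forall p (v : E p), linear (fun u => form2_val u v);
  form2_linearr : forall p (u : E p), linear (form2_val u);
  form2_alt : forall p (u : E p), form2_val u u = 0;
  form2_smooth : forall a b : Gamma E,
    smooth_section (fun p => form2_val (a p) (b p)) }.

Definition form2_ev E F (w : form2 E F) (a b : Gamma E) : Gamma F :=
  MkGamma (form2_smooth w a b).

Program Definition form2_0 (E F : bundle M) : form2 E F :=
  @Form2 E F (fun _ _ _ => 0) _ _ _ _.
Next Obligation. by move=> E F p v k a b /=; rewrite scaler0 addr0. Qed.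
Next Obligation. by move=> E F p v k a b /=; rewrite scaler0 addr0. Qed.
Next Obligation. by move=> *. Qed.
Next Obligation. by move=> *; exact: smooth_section0. Qed.

Program Definition form2_sub (E F : bundle M) (w t : form2 E F) : form2 E F :=
  @Form2 E F (fun p u v => w p u v - t p u v) _ _ _ _.
Next Obligation.
by move=> E F w t p v k a b; rewrite !form2_linearl scalerBr opprD addrACA.
Qed.
Next Obligation.
by move=> E F w t p v k a b; rewrite !form2_linearr scalerBr opprD addrACA.
Qed.
Next Obligation. by move=> E F w t p u /=; rewrite !form2_alt subrr. Qed.
Next Obligation.
move=> E F w t a b; have := section_smooth (form2_ev w a b - form2_ev t a b).
congr smooth_section; apply: functional_extensionality_dep => p.
by rewrite GammaDE GammaNE.
Qed.

(* Sections of Lambda^3 T^*M. *)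
Record form3 := Form3 {
  form3_val :> forall p : M, tangent p -> tangent p -> tangent p -> R^o;
  form3_linear1 : forall p (v w : tangent p),
    linear (fun u => form3_val u v w);
  form3_linear2 : forall p (u w : tangent p),
    linear (fun v => form3_val u v w);
  form3_linear3 : forall p (u v : tangent p), linear (form3_val u v);
  form3_alt12 : forall p (u v : tangent p), form3_val u u v = 0;
  form3_alt23 : forall p (u v : tangent p), form3_val u v v = 0;
  form3_smooth : forall X Y Z : Gamma (TM M),
    smooth_on setT (fun p => form3_val (X p) (Y p) (Z p)) }.

HB.instance Definition _ E F := gen_eqMixin (form2 E F).
HB.instance Definition _ E F := gen_choiceMixin (form2 E F).

Definition Omega1 := Gamma (TstarM M).
Definition Omega2 := form2 (TM M) (line M).
Definition Omega3 := form3.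
Definition Omega2TM := form2 (TM M) (TM M).

End Forms2.
Arguments Omega1 {R n} M.
Arguments Omega2 {R n} M.
Arguments Omega3 {R n} M.
Arguments Omega2TM {R n} M.

Section Calculus.
Variables (R : realType) (n : nat) (M : manifold R n).
Implicit Types (X Y Z : Gamma (TM M)) (f : Cinf M) (al be : Omega1 M)
  (w : Omega2 M) (T : Omega2TM M) (H : Omega3 M).

(* The exterior derivative of a 1-form: the unique 2-form satisfying the
   invariant formula (the default 0 is never used, as such a 2-form exists). *)
Definition d1 al : Omega2 M :=
  xget (form2_0 _ _) [set w : Omega2 M | forall X Y p,
    w p (X p) (Y p) =
    X p (pairing1 al Y) - Y p (pairing1 al X) - al p (lie X Y p)].

Fact contract2_linear X w p :
  (fun v : tangent p => w p (X p) v) \in @linear_form_on_tangent _ _ _ p.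
Proof. by apply/asboolP ; exact: (form2_linearr w (X p)). Qed.

Definition contract2_at X w p : cotangent p :=
  MkCotangent (contract2_linear X w p).

Fact contract2_smooth X w :
  @smooth_section _ _ _ (TstarM M) (contract2_at X w).
Proof. by move=> Y; exact: (form2_smooth w X Y). Qed.

(* iota_X w *)
Definition contract2 X w : Omega1 M := MkGamma (contract2_smooth X w).

Fact contract3_linear X Y H p :
  (fun v : tangent p => H p (X p) (Y p) v) \in @linear_form_on_tangent _ _ _ p.
Proof. by apply/asboolP ; exact: (form3_linear3 H (X p) (Y p)). Qed.

Definition contract3_at X Y H p : cotangent p :=
  MkCotangent (contract3_linear X Y H p).

Fact contract3_smooth X Y H :
  @smooth_section _ _ _ (TstarM M) (contract3_at X Y H).
Proof. by move=> Z; exact: (form3_smooth H X Y Z). Qed.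

(* iota_Y iota_X H = H(X, Y, -) *)
Definition contract3 X Y H : Omega1 M := MkGamma (contract3_smooth X Y H).

(* The derivation iota_T in the degrees 0 and 1, where its defining properties
   give it outright; d^T and L^T are only needed there. *)
Definition iotaT0 T f : Omega1 M := 0.

Program Definition iotaT1 T al : Omega2 M :=
  @Form2 _ _ _ (TM M) (line M) (fun p u v => al p (T p u v)) _ _ _ _.
Next Obligation.
move=> T al p v k a b; by rewrite form2_linearl cotangent_linear.
Qed.
Next Obligation.
move=> T al p v k a b; by rewrite form2_linearr cotangent_linear.
Qed.
Next Obligation.
by move=> T al p u /=; rewrite form2_alt cotangent0.
Qed.
Next Obligation.
by move=> T al X Y; exact: (section_smooth al (form2_ev T X Y)).
Qed.

(* d^T = d - iota_T *)
Definition dT0 T f : Omega1 M := d0 f - iotaT0 T f.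
Definition dT1 T al : Omega2 M := form2_sub (d1 al) (iotaT1 T al).

(* L^T_X al = iota_X d^T al + d^T iota_X al *)
Definition LieT T X al : Omega1 M :=
  contract2 X (dT1 T al) + dT0 T (pairing1 al X).

(* [X, Y]^T *)
Definition lieT T X Y : Gamma (TM M) := lie X Y + form2_ev T X Y.

End Calculus.

(* A tuple (E, <,>, rho, [,]) over M, before any axiom on the bracket. *)
Record algebroid (R : realType) (n : nat) (M : manifold R n) := Algebroid {
  abundle :> bundle M;
  apair : forall p, abundle p -> abundle p -> R^o;
  apair_linear : forall p (v : abundle p), linear (fun u => apair u v);
  apair_sym : forall p (u v : abundle p), apair u v = apair v u;
  apair_nondegenerate : forall p (u : abundle p),
    (forall v, apair u v = 0) -> u = 0;
  apair_smooth : forall a b : Gamma abundle,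
    smooth_on setT (fun p => apair (a p) (b p));
  anchor : bundle_morphism abundle (TM M);
  abracket : Gamma abundle -> Gamma abundle -> Gamma abundle }.

Section Algebroids.
Variables (R : realType) (n : nat) (M : manifold R n).
Implicit Types (A B : algebroid M).

Definition ip A (a b : Gamma A) : Cinf M := mkCinf (apair_smooth a b).

Definition rho A (a : Gamma A) : Gamma (TM M) := push (anchor A) a.

(* rho^* : the unique element e with <e, b> = al(rho b) for all b; it exists
   by nondegeneracy when the fibers are finite-dimensional. *)
Definition rhostar A p (al : cotangent p) : A p :=
  xget 0 [set e : A p | forall b : A p, apair e b = al (anchor A p b)].

Definition is_metric_algebroid A : Prop :=
  [/\ is_vector_bundle A,
      (forall b : Gamma A, linear (fun a => abracket a b)) /\
      (forall a : Gamma A, linear (abracket a)),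
      forall (a b : Gamma A) p,
        (abracket a b + abracket b a) p = rhostar A (d0 (ip a b) p)
    & forall a b c : Gamma A,
        act (rho a) (ip b c) = ip (abracket a b) c + ip b (abracket a c)].

Definition curvature A (a b : Gamma A) : Gamma (TM M) :=
  rho (abracket a b) - lie (rho a) (rho b).

Definition is_curved_Courant A : Prop :=
  is_metric_algebroid A /\
  exists F : form2 A (TM M),
    (forall a b : Gamma A, form2_ev F a b = curvature a b) /\
    (forall p (u v : A p), anchor A p u = 0 -> F p u v = 0).

Definition is_exact A : Prop :=
  forall p,
    [/\ injective (@rhostar A p),
        forall e : A p, anchor A p e = 0 <-> exists al, e = rhostar A al
      & forall v : tangent p, exists e : A p, anchor A p e = v].

Definition algebroid_isomorphic A B : Prop :=
  exists phi : bundle_morphism A B,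
    [/\ is_bundle_isomorphism phi,
        forall p (u v : A p), apair (phi p u) (phi p v) = apair u v,
        forall p (u : A p), anchor B p (phi p u) = anchor A p u
      & forall a b : Gamma A,
          abracket (push phi a) (push phi b) = push phi (abracket a b)].

End Algebroids.

(* (TM (+) T^*M, <,>_+, pr_TM, [,]^T_H) *)
Section Standard.
Variables (R : realType) (n : nat) (M : manifold R n).
Variables (T : Omega2TM M) (H : Omega3 M).

Local Notation E := (dsum (TM M) (TstarM M)).

Definition std_pair p (u v : E p) : R^o := u.2 v.1 + v.2 u.1.

Definition std_bracket (a b : Gamma E) : Gamma E :=
  let X := dsum1 a in let al := dsum2 a in
  let Y := dsum1 b in let be := dsum2 b in
  dsum_pair (lieT T X Y)
    (LieT T X be - contract2 Y (dT1 T al) + contract3 X Y H).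

Fact std_pair_linear p v : linear (fun u : E p => std_pair u v).
Proof.
move=> k a b; rewrite /std_pair /= cotangent_linear.
rewrite -[LHS]/((k * a.2 v.1 + b.2 v.1) + (k * v.2 a.1 + v.2 b.1)).
by rewrite /GRing.scale /=; ring.
Qed.

Fact std_pair_sym p (u v : E p) : std_pair u v = std_pair v u.
Proof. exact: addrC. Qed.

Fact std_pair_nondegenerate p (u : E p) :
  (forall v, std_pair u v = 0) -> u = 0.
Proof.
case: u => X al uv; congr (_, _); apply/val_inj/funext.
- move=> f; have := uv (0, differential_at f p).
  rewrite /std_pair /=.
  by rewrite cotangent0 add0r.
- by move=> Y; have := uv (Y, 0); rewrite /std_pair /= addr0.
Qed.

Fact std_pair_smooth (a b : Gamma E) :
  smooth_on setT (fun p => std_pair (a p) (b p)).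
Proof.
exact: Cinf_smooth
  (pairing1 (dsum2 a) (dsum1 b) + pairing1 (dsum2 b) (dsum1 a)).
Qed.

Definition prTM : bundle_morphism E (TM M).
Proof.
exists (fun p => fst : {linear (tangent p * cotangent p)%type -> tangent p}).
by move=> a; exact: section_smooth (dsum1 a).
Defined.

Definition standard_algebroid : algebroid M :=
  Algebroid std_pair_linear std_pair_sym std_pair_nondegenerate
    std_pair_smooth prTM std_bracket.

End Standard.

(* Main.v *)
From HB Require Import structures.
Require Import Defs.
From mathcomp Require Import all_boot all_order all_algebra.
From mathcomp Require Import all_classical all_reals all_analysis.
From mathcomp Require Import ring lra.

Set Implicit Arguments.
Unset Strict Implicit.
Unset Printing Implicit Defensive.

Import Order.TTheory GRing.Theory Num.Theory.
Import numFieldNormedType.Exports.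

Local Open Scope classical_set_scope.
Local Open Scope ring_scope.

(** Choose a smooth splitting s of the anchor rho : A -> TM, made isotropic by
    subtracting half of the symmetric form <s X, s Y>. Exactness says that ker
    rho is the image of rho^*, so that e |-> (rho e, <e, s ->) is an isomorphism
    A -> TM (+) T^*M with inverse (X, al) |-> s X + rho^* al, and it carries the
    pairing of A to the canonical one ([pair_decompose]). Set
    T(X, Y) = F(s X, s Y), with F the curvature of the anchor, and
    H(X, Y, Z) = <[s X, s Y], s Z>. The brackets that involve rho^* are forced
    by invariance of the pairing and by the curvature, as F annihilates ker rho
    ([ip_sig_rs], [ip_rs_sig], [ip_rs_rs]); comparing with the definition of the
    bracket twisted by T and H is then a computation ([standard_form]).

    Two points need analysis. One is the existence of s ([splitting]). Locally,
    A has enough global sections thanks to bump functions ([exists_bump],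
    [local_frame]). The fibre of A at p being an extension of T_p M by its dual,
    the tangent spaces have constant finite dimension ([dual_basis_rank]). Hence
    the anchors of suitable sections of A form a local frame of TM, and mapping
    this frame back to those sections splits rho locally ([local_splitting]).
    The local splittings are glued by a recursion along a countable basis of the
    topology that becomes stationary near every point.

    The other point is that H and the exterior derivative of a 1-form, which are
    given on vector fields, come from forms on tangent vectors
    ([form3_of_tensor], [d1E]). They are linear over smooth functions, and a
    vector field vanishing at p is a combination of vector fields with
    coefficients vanishing at p, because the same holds for sections of A
    ([vanishing_section], [vanishing_vf]). *)

(** * A family of flat functions on the line *)

Section Flat.
Variable R : realType.
Implicit Types (p : {poly R}) (t : R).

(** The functions p(1/t) exp(-1/t), extended by 0 to t <= 0. Letting the
    polynomial p vary makes the family stable under differentiation, so that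
    smoothness needs only one derivative, computed in [flat_derive]. *)
Definition flat p t : R := if 0 < t then p.[t^-1] * expR (- t^-1) else 0.

(** With u = 1/t, so that u' = - u^2, the derivative of p(u) exp(-u) is
    (p(u) - p'(u)) u^2 exp(-u). *)
Definition dflat p : {poly R} := (p - p^`()) * 'X^2.

Lemma flat_le0 p t : t <= 0 -> flat p t = 0.
Proof. by rewrite /flat ltNge => ->. Qed.

Lemma flatE p t : 0 < t -> flat p t = p.[t^-1] * expR (- t^-1).
Proof. by rewrite /flat => ->. Qed.

Lemma poly_growth p : exists2 C : R, 0 <= C &
  forall u : R, 1 <= u -> `|p.[u]| <= C * u ^+ size p.
Proof.
exists (\sum_(i < size p) `|p`_i|) => [|u u1]; first exact: sumr_ge0.
rewrite horner_coef mulr_suml; apply: le_trans (ler_norm_sum _ _ _) _.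
apply: ler_sum => i _; rewrite normrM ler_wpM2l// normrX ger0_norm; last lra.
exact/(ler_weXn2l u1)/ltnW.
Qed.

(** The exponential beats every power: exp u >= u^(N+1) / (N+1)! with u = 1/t
    and N the size of p. *)
Lemma flat_bound p : exists2 C : R, 0 <= C &
  forall t, `|t| < 1 -> `|flat p t| <= C * `|t|.
Proof.
have [C C0 pC] := poly_growth p.
exists (C * (size p).+1`!%:R) => [|t t1]; first by rewrite mulr_ge0.
have [t0|t0] := leP t 0; first by rewrite flat_le0// normr0 !mulr_ge0.
rewrite flatE// [`|t|]gtr0_norm// normrM (ger0_norm (expR_ge0 _)).
have tV : 1 <= t^-1 by rewrite invf_ge1// ltW// -(gtr0_norm t0).
set u := t^-1 in tV *; have u0 : 0 < u by lra.
have -> : t = u^-1 by rewrite invrK.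
apply: le_trans (ler_wpM2r (expR_ge0 _) (pC _ tV)) _.
rewrite -!mulrA ler_wpM2l// expRN ler_pdivrMr ?expR_gt0// mulrAC.
rewrite -ler_pdivrMr ?invr_gt0// invrK -exprSr -ler_pdivrMl//.
have := expR_ge1Dxn (size p) (ltW u0); rewrite mulrC; lra.
Qed.

(** At the origin the difference quotient of [flat p] is [flat (p * 'X)],
    which tends to 0 by [flat_bound]; away from it this is the chain rule. *)
Lemma flat_derive p t : is_derive t 1 (flat p) (flat (dflat p) t).
Proof.
have [t0|t0|->] := ltrgtP t 0; last 1 first.
- rewrite (flat_le0 (dflat p) (lexx 0)).
  suff h : h^-1 *: ((flat p \o shift 0) (h *: 1) - flat p 0) @[h --> 0^'] -->
      (0 : R) by split; [exact: cvgP h|exact: cvg_lim h].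
  have [C C0 pC] := flat_bound (p * 'X).
  have C1 : 0 < C + 1 by lra.
  apply/cvgr0Pnorm_le => e e0; near=> h.
  have h0 : h != 0 by near: h; exact: nbhs_dnbhs_neq.
  have -> : h^-1 *: ((flat p \o shift 0) (h *: 1) - flat p 0) =
      flat (p * 'X) h.
    rewrite /= addr0 (flat_le0 p (lexx 0)) subr0 [h *: 1]mulr1 /GRing.scale /=.
    have [hl|hl] := leP h 0; first by rewrite !flat_le0 ?mulr0.
    by rewrite !flatE// hornerMX mulrCA mulrA.
  have h1 : `|h| < 1 by near: h; apply: dnbhs0_lt; exact: ltr01.
  apply: (le_trans (pC h h1)).
  apply: (@le_trans _ _ ((C + 1) * `|h|)); first by rewrite ler_wpM2r//; lra.
  rewrite mulrC -ler_pdivlMr//.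
  by near: h; apply: dnbhs0_le; exact: divr_gt0.
- rewrite flat_le0 ?ltW//; apply: near_eq_is_derive (is_derive_cst _ _ _).
  near=> x; rewrite flat_le0//; near: x; apply: filterS (lt_nbhsl t0) => x.
  exact: ltW.
- have h : is_derive t 1 (fun x => p.[x^-1] * expR (- x^-1)) (flat (dflat p) t).
    have iV : is_derive t 1 (fun x : R => x^-1) (- t ^- 2 *: 1).
      by apply: is_deriveV; rewrite gt_eqF.
    have pV : is_derive t 1 (fun x => p.[x^-1]) (p^`().[t^-1] * (- t ^- 2 *: 1)).
      exact: (is_derive1_comp (f := horner p)).
    have eV : is_derive t 1 (fun x => expR (- x^-1))
        (expR (- t^-1) * - (- t ^- 2 *: 1)).
      exact: (is_derive1_comp (f := expR)).
    apply: is_derive_eq; rewrite flatE// /dflat /GRing.scale /= hornerM hornerXn hornerD hornerN.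
    by rewrite exprVn; ring.
  apply: near_eq_is_derive h; near=> x; rewrite flatE//; near: x.
  exact: lt_nbhsr.
Unshelve. all: by end_near. Qed.

End Flat.

(** * Functions of class C^k on open subsets of Euclidean space *)

Section CkMore.
Variables (R : realType) (n : nat).
Implicit Types (U V : set 'rV[R]_n) (f g : 'rV[R]_n -> R).

Lemma Ck_sub k U V f : V `<=` U -> Ck k U f -> Ck k V f.
Proof.
move=> VU; elim: k f => [|k IH] f [fc fd]; first by split=> // x /VU /fc.
split=> [x /VU /fc //|i]; have [di ci] := fd i.
by split=> [x /VU /di //|]; exact: IH.
Qed.

Lemma Ck_local k U f :
  (forall x, U x -> exists2 V, V x & Ck k V f) -> Ck k U f.
Proof.
elim: k f => [|k IH] f loc; split=> //.
- by move=> x /loc[V Vx CV]; exact: Ck_cont CV Vx.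
- by move=> x /loc[V Vx CV]; exact: Ck_cont CV Vx.
move=> i; split=> [x /loc[V Vx [_ CV]]|]; first by have [fd _] := CV i; exact: fd.
by apply: IH => x /loc[V Vx [_ CV]]; exists V => //; have [_] := CV i.
Qed.

(** A directional derivative is the derivative of a function of one real
    variable, so this reduces to the chain rule on the line. *)
Lemma is_derive_comp_dir (h : R -> R) f x v a b :
  is_derive (f x) 1 h a -> is_derive x v f b ->
  is_derive x v (fun y => h (f y)) (a * b).
Proof.
have E (g : 'rV[R]_n -> R) :
    (fun h => h^-1 *: ((g \o shift x) (h *: v) - g x)) =
    (fun h => h^-1 *: (((fun k : R => g (k *: v + x)) \o shift 0) (h *: 1) -
               g (0 *: v + x))).
  by apply/funext => k /=; rewrite addr0 scale0r add0r [k *: 1]mulr1.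
move=> dh [fd fb].
have df : is_derive (0 : R) 1 (fun k : R => f (k *: v + x)) b.
  by split; [exact: (derivable1P f x v).1|rewrite -fb /derive E].
have f0 : f x = (fun k : R => f (k *: v + x)) 0 by rewrite scale0r add0r.
rewrite f0 in dh; have [cd cv] := is_derive1_comp dh df.
split; first exact: (derivable1P (fun y => h (f y)) x v).2.
by rewrite -cv /derive (E (fun y => h (f y))).
Qed.

(** Induction on k for all polynomials at once: a partial derivative of
    [flat p (f x)] is [flat (dflat p) (f x)] times one of f. *)
Lemma Ck_flat k U f (p : {poly R}) : open U -> Ck k U f ->
  Ck k U (fun x => flat p (f x)).
Proof.
move=> oU; elim: k p => [|k IH] p Cf.
  split=> // x Ux; apply: continuous_comp; first exact: Ck_cont Cf Ux.
  by apply/differentiable_continuous/derivable1_diffP; case: (flat_derive p (f x)).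
have D i x : U x ->
    is_derive x 'e_i (fun y => flat p (f y)) (flat (dflat p) (f x) * 'D_'e_i f x).
  move=> Ux; apply: is_derive_comp_dir; first exact: flat_derive.
  by apply: derivableP; exact: (Cf.2 i).1.
split=> [x Ux|i].
  apply: continuous_comp; first exact: Ck_cont Cf Ux.
  by apply/differentiable_continuous/derivable1_diffP; case: (flat_derive p (f x)).
split=> [x Ux|]; first by case: (D i x Ux).
apply: Ck_ext (CkM oU (IH (dflat p) (CkS Cf)) (Cf.2 i).2) => // x Ux.
by case: (D i x Ux).
Qed.

Lemma Ck_inv k U f : open U -> (forall x, U x -> f x != 0) -> Ck k U f ->
  Ck k U (fun x => (f x)^-1).
Proof.
move=> oU f0; elim: k => [|k IH] Cf.
  by split=> // x Ux; apply: continuousV; [exact: f0|exact: Ck_cont Cf Ux].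
split=> [x Ux|i]; first by apply: continuousV; [exact: f0|exact: Ck_cont Cf Ux].
have [fd fc] := Cf.2 i; split=> [x Ux|].
  by apply: derivableV; [exact: f0|exact: fd].
have CfV := IH (CkS Cf).
apply: Ck_ext (CkM oU (CkM oU (Ck_cst k U (-1)) (CkM oU CfV CfV)) fc) => // x Ux.
by rewrite deriveV ?f0//; [rewrite /GRing.scale /= mulN1r -invfM -expr2|exact: fd].
Qed.

End CkMore.

(** * Smooth functions on open subsets of a manifold *)

Section SmoothMore.
Variables (R : realType) (n : nat) (M : manifold R n).
Implicit Types (U V W : set M) (f g : M -> R) (p : M).

Definition chart_inv (i : atlas M) (x : 'rV[R]_n) : option M :=
  if pselect (exists p, dom i p /\ chart i p = x) is left h
  then Some (projT1 (cid h)) else None.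

Lemma chartK i p : dom i p -> chart_inv i (chart i p) = Some p.
Proof.
move=> ip; rewrite /chart_inv; case: pselect => [h|[]]; last by exists p.
by case: cid => q /= [iq qp]; congr Some; exact: (chart_inj iq ip qp).
Qed.

Definition in_chart f i x : R := if chart_inv i x is Some p then f p else 0.

Lemma in_chartE f i p : dom i p -> in_chart f i (chart i p) = f p.
Proof. by move=> ip; rewrite /in_chart chartK. Qed.

(** Smoothness asks for some local representative in each chart. Replacing it
    by the canonical one turns smoothness into a pointwise local condition. *)
Lemma smooth_onE U f : open U -> smooth_on U f <->
  forall i, Csmooth (chart i @` (U `&` dom i)) (in_chart f i).
Proof.
move=> oU; split=> sf i; last first.
  by exists (in_chart f i) => // p _ ip; rewrite in_chartE.
have [F sF fF] := sf i => k; apply: Ck_ext (sF k); first exact: open_chartI.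
by move=> _ [p [Up ip] <-]; rewrite in_chartE// fF.
Qed.

Lemma smooth_on_ext U f g : (forall p, U p -> f p = g p) ->
  smooth_on U f -> smooth_on U g.
Proof.
move=> fg sf i; have [F sF fF] := sf i; exists F => // p Up ip.
by rewrite -fg// fF.
Qed.

Lemma smooth_on_sub U V f : V `<=` U -> smooth_on U f -> smooth_on V f.
Proof.
move=> VU sf i; have [F sF fF] := sf i; exists F => [k|p /VU]; last exact: fF.
by apply: Ck_sub (sF k) => _ [p [/VU Up ip] <-]; exists p.
Qed.

Lemma smooth_on_local U f : open U ->
  (forall p, U p -> exists V, [/\ open V, V p & smooth_on V f]) ->
  smooth_on U f.
Proof.
move=> oU loc; apply/smooth_onE => // i k; apply: Ck_local => _ [p [Up ip] <-].
have [V [oV Vp /(smooth_onE _ oV)/(_ i k) sV]] := loc p Up.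
by exists (chart i @` (V `&` dom i)) => //; exists p.
Qed.

Lemma smooth_on_flat U f (q : {poly R}) : open U -> smooth_on U f ->
  smooth_on U (fun p => flat q (f p)).
Proof.
move=> oU sf i; have [F sF fF] := sf i.
exists (fun x => flat q (F x)) => [k|p Up ip]; last by rewrite fF.
by apply: Ck_flat; [exact: open_chartI|exact: sF].
Qed.

Lemma smooth_on_inv U f : open U -> (forall p, U p -> f p != 0) ->
  smooth_on U f -> smooth_on U (fun p => (f p)^-1).
Proof.
move=> oU f0 sf i; have [F sF fF] := sf i.
exists (fun x => (F x)^-1) => [k|p Up ip]; last by rewrite fF.
apply: Ck_inv; [exact: open_chartI| |exact: sF].
by move=> _ [p [Up ip] <-]; rewrite -fF// f0.
Qed.

Lemma smooth_on_prod U (I : Type) (r : seq I) (P : pred I) (F : I -> M -> R) :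
  open U -> (forall i, P i -> smooth_on U (F i)) ->
  smooth_on U (fun p => \prod_(i <- r | P i) F i p).
Proof.
move=> oU sF; elim: r => [|i r IH].
  apply: smooth_on_ext (smooth_on_cst U 1) => p _; by rewrite big_nil.
case Pi: (P i); last first.
  by apply: smooth_on_ext IH => p _; rewrite big_cons Pi.
apply: smooth_on_ext (smooth_onM oU (sF i Pi) IH) => p _.
by rewrite big_cons Pi.
Qed.

(** In another chart this coordinate is a component of the transition map.
    Bump functions are built from these functions by ring operations and
    [flat]. *)
Lemma smooth_on_coord i (a : 'I_n) : smooth_on (dom i) (fun p => chart i p 0 a).
Proof.
move=> j; have [tau [stau tauE]] := chart_transition j i.
exists (fun x => tau x 0 a) => [|p ip jp]; last by rewrite (tauE p).
by rewrite setIC; exact: stau.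
Qed.

Lemma smooth_on_continuous U f p : open U -> smooth_on U f -> U p ->
  {for p, continuous f}.
Proof.
move=> oU sf Up; have [i ip] := dom_cover p; have [F sF fF] := sf i.
have FC : {for chart i p, continuous F} by apply: Ck_cont (sF 0) _; exists p.
have c : {for p, continuous (fun q => F (chart i q))}.
  by apply: continuous_comp => //; exact: chart_continuous.
rewrite /prop_for /continuous_at fF//; apply: cvg_trans c.
apply: near_eq_cvg.
have oV : open_nbhs p (U `&` dom i).
  by split; [apply: openI => //; exact: dom_open|split].
by apply: filterS (open_nbhs_nbhs oV) => q [Uq iq]; rewrite fF.
Qed.

Lemma open_neq0 (f : Cinf M) : open [set p | f p != 0].
Proof.
apply: (@open_comp _ _ f [set x : R | x != 0]).
  move=> p _; exact: (smooth_on_continuous openT (Cinf_smooth f)).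
exact: open_neq.
Qed.

Lemma open_gt_Cinf (f : Cinf M) (c : R) : open [set p | c < f p].
Proof.
apply: (@open_comp _ _ f [set x : R | c < x]); last exact: open_gt.
move=> p _; exact: (smooth_on_continuous openT (Cinf_smooth f)).
Qed.

End SmoothMore.

(** * Bump functions *)

Section Bump.
Variables (R : realType) (n : nat) (M : manifold R n).
Implicit Types (U V W K : set M) (p q : M).

Lemma flat1_ge0 (t : R) : 0 <= flat 1 t.
Proof. by rewrite /flat; case: ifP => // _; rewrite hornerC mul1r expR_ge0. Qed.

Lemma flat1_gt0 (t : R) : 0 < t -> 0 < flat 1 t.
Proof. by move=> t0; rewrite flatE// hornerC mul1r expR_gt0. Qed.

(** Charts are open maps. *)
Lemma chart_inv_continuous (i : atlas M) p q : dom i q ->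
  {for chart i q, continuous (fun x => odflt p (chart_inv i x))}.
Proof.
move=> iq; rewrite /prop_for /continuous_at chartK//= => N.
rewrite /= nbhsE => -[N' [oN' N'q] N'N].
have oD : open (N' `&` dom i) by apply: openI => //; exact: dom_open.
have oC : open_nbhs (chart i q) (chart i @` (N' `&` dom i)).
  by split; [apply: chart_open => //; exact: subIsetr|exists q].
apply: filterS (open_nbhs_nbhs oC) => _ [q' [N'q' iq'] <-].
by rewrite /= chartK//=; exact: N'N.
Qed.

(** A closed box around [chart i p] inside the image of U is compact, hence so
    is its preimage in M, which is closed because M is Hausdorff. *)
Lemma exists_box U i p : open U -> U p -> dom i p -> exists2 d : R, 0 < d &
  let K := [set q | dom i q /\
      forall a : 'I_n, `|chart i q 0 a - chart i p 0 a| <= d] in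
  closed K /\ K `<=` U.
Proof.
move=> oU Up ip; set c := chart i p.
have oO := @open_chartI _ _ _ _ i oU.
have [e /= e0 eO] : nbhs_ball c (chart i @` (U `&` dom i)).
  by apply/nbhs_ballP/open_nbhs_nbhs; split=> //; exists p.
have e20 : 0 < e / 2 by exact: divr_gt0.
exists (e / 2) => //; set K := (X in closed X).
pose B := [set x : 'rV[R]_n | forall a : 'I_n, `|x 0 a - c 0 a| <= e / 2].
have BO x : B x -> exists2 q, U q /\ dom i q & chart i q = x.
  move=> Bx; suff /eO [q Uq qx] : ball c e x by exists q.
  split=> [|k l]; first by exact: e0.
  rewrite ord1 /ball/= distrC; apply: le_lt_trans (Bx l) _; lra.
have cB : compact B.
  have -> : B = [set x | forall a : 'I_n,
      `[c 0 a - e / 2, c 0 a + e / 2]%classic (x ord0 a)].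
    apply/seteqP; split=> x Bx a; have := Bx a;
      by rewrite /= in_itv/= ler_distl.
  apply: (@rV_compact R n (fun a => `[c 0 a - e / 2, c 0 a + e / 2]%classic)).
  by move=> a; exact: segment_compact.
have KB : K = (fun x => odflt p (chart_inv i x)) @` B.
  apply/seteqP; split=> [q [iq Bq]|_ [x Bx <-]].
    by exists (chart i q) => //=; rewrite chartK.
  by have [q [Uq iq] qx] := BO x Bx; rewrite -qx chartK//=; split=> //; rewrite qx.
split.
  apply: compact_closed; first exact: manifold_hausdorff.
  rewrite KB; apply: continuous_compact cB.
  apply: continuous_in_subspaceT => x /set_mem Bx.
  have [q [Uq iq] <-] := BO x Bx; exact: chart_inv_continuous.
move=> q [iq Bq]; have [q' [Uq' iq'] qx] := BO _ Bq.
by rewrite -(chart_inj iq' iq qx).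
Qed.

(** In a chart, take the product over the coordinates x_a of
    exp(-1/(d^2 - (x_a - c_a)^2)), cut off at 0: it is positive exactly inside
    a box of radius d. Being supported in a closed subset of the chart domain,
    it extends smoothly by 0. *)
Lemma exists_positive_bump U p : open U -> U p -> exists g : M -> R,
  [/\ smooth_on setT g, 0 < g p
    & exists K, [/\ closed K, K `<=` U & forall q, ~ K q -> g q = 0]].
Proof.
move=> oU Up; have [i ip] := dom_cover p.
have [d d0 [cK KU]] := exists_box oU Up ip; set K := (X in closed X) in cK KU.
pose G q := \prod_(a < n) flat 1 (d ^+ 2 - (chart i q 0 a - chart i p 0 a) ^+ 2).
pose g q := if pselect (dom i q) is left _ then G q else 0.
have gG q : dom i q -> g q = G q by rewrite /g; case: pselect.
have g0 q : ~ K q -> g q = 0.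
  move=> nK; rewrite /g; case: pselect => // iq.
  have /existsNP[a /negP] : ~ forall a, `|chart i q 0 a - chart i p 0 a| <= d.
    by move=> h; apply: nK.
  rewrite -ltNge => da; rewrite /G (bigD1 a)//= flat_le0 ?mul0r//.
  by rewrite subr_le0 -[leRHS]real_normK ?num_real// lerXn2r ?nnegrE// ltW.
exists g; split.
- apply: smooth_on_local => [|q _]; first exact: openT.
  have [iq|iq] := pselect (dom i q).
    exists (dom i); split=> //; first exact: dom_open.
    apply: (@smooth_on_ext _ _ _ _ G) => [r ir|]; first by rewrite gG.
    have oi := @dom_open _ _ M i.
    apply: smooth_on_prod => // a _; apply: smooth_on_flat => //.
    have sc : smooth_on (dom i) (fun q => chart i q 0 a - chart i p 0 a).
      by apply: smooth_onD => //; [exact: smooth_on_coord|exact: smooth_on_cst].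
    apply: smooth_on_ext (smooth_onD oi (smooth_on_cst _ (d ^+ 2))
      (smooth_onM oi (smooth_on_cst _ (-1)) (smooth_onM oi sc sc))) => r _.
    by rewrite mulN1r -expr2.
  exists (~` K); split; [exact: closed_openC|by case|].
  by apply: smooth_on_ext (smooth_on_cst _ 0) => r /g0.
- rewrite gG//; apply: prodr_gt0 => a _; apply: flat1_gt0.
  by rewrite subrr expr0n subr0 exprn_gt0.
- by exists K.
Qed.

(** Compose a positive bump f, scaled to exceed 1 near p, with the smooth step
    h(t) / (h(t) + h(1 - t)), where h(t) = exp(-1/t) for t > 0: it is 0 for
    t <= 0 and 1 for t >= 1. *)
Lemma exists_bump U p : open U -> U p -> exists chi : Cinf M,
  (exists W, [/\ open W, W p & forall q, W q -> chi q = 1]) /\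
  (exists K, [/\ closed K, K `<=` U & forall q, ~ K q -> chi q = 0]).
Proof.
move=> oU Up; have [g [sg gp [K [cK KU gK]]]] := exists_positive_bump oU Up.
pose f q := 2 * (g p)^-1 * g q.
have oT := @openT M.
have sf : smooth_on setT f by apply: smooth_onM => //; exact: smooth_on_cst.
have s1f : smooth_on setT (fun q => 1 - f q).
  apply: smooth_on_ext (smooth_onD oT (smooth_on_cst _ 1)
    (smooth_onM oT (smooth_on_cst _ (-1)) sf)) => q _; by rewrite mulN1r.
pose D q := flat 1 (f q) + flat 1 (1 - f q).
have D0 q : D q != 0.
  rewrite gt_eqF// /D; have [fq|fq] := ltP 0 (f q).
    by rewrite ltr_pwDl ?flat1_ge0 ?flat1_gt0.
  by rewrite ltr_wpDl ?flat1_ge0 ?flat1_gt0//; lra.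
have sD : smooth_on setT D by apply: smooth_onD => //; exact: smooth_on_flat.
have sc : smooth_on setT (fun q => flat 1 (f q) * (D q)^-1).
  by apply: smooth_onM => //; [exact: smooth_on_flat|exact: smooth_on_inv].
exists (mkCinf sc); split.
  exists [set q | 1 < mkCinf sf q]; split; first exact: open_gt_Cinf.
    by rewrite /= /f mulfVK ?gt_eqF//; lra.
  move=> q /= fq; have Dq : D q = flat 1 (f q).
    by rewrite /D [X in _ + X]flat_le0 ?addr0//; lra.
  by rewrite -Dq divff.
by exists K; split=> // q nK /=; rewrite /f (gK q nK) mulr0 flat_le0 ?mul0r.
Qed.

End Bump.

(** * Germs of smooth functions *)

Section CinfTheory.
Variables (R : realType) (n : nat) (M : manifold R n).
Implicit Types (f g : Cinf M) (p q : M) (U V W K : set M).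

Lemma CinfP f g : (forall p, f p = g p) -> f = g.
Proof. by move=> fg; apply/val_inj/funext. Qed.

Lemma CinfDE f g p : (f + g) p = f p + g p. Proof. by []. Qed.
Lemma CinfNE f p : (- f) p = - f p. Proof. by []. Qed.
Lemma CinfME f g p : (f * g) p = f p * g p. Proof. by []. Qed.
Lemma Cinf0E p : (0 : Cinf M) p = 0. Proof. by []. Qed.
Lemma Cinf1E p : (1 : Cinf M) p = 1. Proof. by []. Qed.

Lemma Cinf_sumE (I : Type) (r : seq I) (P : pred I) (F : I -> Cinf M) p :
  (\sum_(i <- r | P i) F i) p = \sum_(i <- r | P i) F i p.
Proof. by elim/big_rec2: _ => // i _ y _ <-. Qed.

(** Off the closed set K the product vanishes, so f need only be smooth where
    chi can be nonzero. The second open set V allows functions that are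
    themselves only defined on a part of M, such as coordinates in a
    trivialization. *)
Lemma cutoff_smooth (chi : Cinf M) K U V (f : M -> R) :
  open U -> open V -> closed K -> K `<=` U -> (forall q, ~ K q -> chi q = 0) ->
  smooth_on (U `&` V) f -> smooth_on V (fun q => chi q * f q).
Proof.
move=> oU oV cK KU chi0 sf; apply: smooth_on_local => // p Vp.
have [Up|nUp] := pselect (U p).
  exists (U `&` V); split=> //; first exact: openI.
  apply: smooth_onM => //; first exact: openI.
  exact: smooth_on_sub (Cinf_smooth chi).
exists (~` K); split; [exact: closed_openC|by move/KU|].
by apply: smooth_on_ext (smooth_on_cst _ 0) => q /chi0 ->; rewrite mul0r.
Qed.

Lemma extend_germ U (f : M -> R) p : open U -> U p -> smooth_on U f ->
  exists (h : Cinf M) W, [/\ open W, W p & forall q, W q -> h q = f q].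
Proof.
move=> oU Up sf.
have [chi [[W [oW Wp chi1]] [K [cK KU chi0]]]] := exists_bump oU Up.
have sh : smooth_on setT (fun q => chi q * f q).
  apply: cutoff_smooth oU openT cK KU chi0 _; by rewrite setIT.
by exists (mkCinf sh), W; split=> // q Wq /=; rewrite chi1// mul1r.
Qed.

Lemma inverse_germ f p : f p != 0 -> exists (h : Cinf M) W,
  [/\ open W, W p & forall q, W q -> f q != 0 /\ h q = (f q)^-1].
Proof.
move=> fp; have oU := open_neq0 f.
have sV : smooth_on [set q | f q != 0] (fun q => (f q)^-1).
  apply: smooth_on_inv => //.
  exact: smooth_on_sub (Cinf_smooth f).
have [h [W [oW Wp hW]]] := extend_germ oU fp sV.
exists h, (W `&` [set q | f q != 0]); split=> //; first exact: openI.
by move=> q [Wq fq]; rewrite hW.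
Qed.

End CinfTheory.

(** * Local frames of a vector bundle *)

Section Frames.
Variables (R : realType) (n : nat) (M : manifold R n) (E : bundle M) (r : nat).
Hypothesis vE : is_vector_bundle_of_rank E r.
Implicit Types (p q : M) (W : set M).

Lemma smooth_section_local (s : forall p, E p) :
  (forall p, exists W (t : Gamma E),
    [/\ open W, W p & forall q, W q -> s q = t q]) -> smooth_section s.
Proof.
have [J [U [triv [oU covU bijU gU sE]]]] := vE.
move=> loc; apply/sE => j a; apply: smooth_on_local => // p Up.
have [W [t [oW Wp st]]] := loc p; exists (W `&` U j).
split=> //; first exact: openI.
have /sE /(_ j a) := section_smooth t.
move=> /(@smooth_on_sub _ _ _ _ (W `&` U j)) -/(_ (@subIsetr _ _ _)).
by apply: smooth_on_ext => q [Wq _]; rewrite st.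
Qed.

(** Multiplying the basis sections of a trivialization by a bump function makes
    them global without changing them near p. The map [co] reads coordinates in
    the trivialization; near p the coordinates of a global section agree with
    globally defined smooth functions. *)
Lemma local_frame p : exists W (e : 'I_r -> Gamma E)
    (co : forall q, {linear E q -> 'rV[R]_r}),
  [/\ open W, W p,
      forall q v, W q -> v = \sum_a co q v 0 a *: e a q,
      forall q a, W q -> co q (e a q) = delta_mx 0 a
    & forall s : Gamma E, exists c : 'I_r -> Cinf M,
        forall q a, W q -> c a q = co q (s q) 0 a].
Proof.
have [J [U [triv [oU covU bijU gU sE]]]] := vE.
have [j Up] := covU p.
have [chi [[W [oW Wp chi1]] [K [cK KU chi0]]]] := exists_bump (oU j) Up.
have WU : W `<=` U j.
  move=> q Wq; apply: KU; apply: contrapT => /chi0; rewrite chi1// => /eqP.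
  by rewrite oner_eq0.
have tinvP q : exists g : 'rV_r -> E q,
    U j q -> cancel (triv j q) g /\ cancel g (triv j q).
  have [/bijU[g tg gt]|nU] := pselect (U j q); first by exists g.
  by exists (fun=> 0).
pose tinv q := projT1 (cid (tinvP q)).
have trivK q : U j q -> cancel (triv j q) (tinv q).
  by move=> Uq; rewrite /tinv; case: cid => g /= /(_ Uq)[].
have tinvK q : U j q -> cancel (tinv q) (triv j q).
  by move=> Uq; rewrite /tinv; case: cid => g /= /(_ Uq)[].
have se a : smooth_section (fun q => chi q *: tinv q (delta_mx 0 a)).
  apply/sE => k b; have [g sg gE] := gU j k.
  apply: smooth_on_ext (cutoff_smooth (oU j) (oU k) cK KU chi0 (sg a b)).
  move=> q Uk; rewrite linearZ mxE; have [Uj|nUj] := pselect (U j q).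
    by rewrite (gE q Uj Uk) tinvK// -rowE mxE.
  by rewrite chi0 ?mul0r// => /KU.
exists W, (fun a => MkGamma (se a)), (triv j); split=> //=.
- move=> q v Wq; have Uq := WU q Wq; apply: (can_inj (trivK q Uq)).
  rewrite linear_sum [LHS]row_sum_delta; apply: eq_bigr => a _.
  by rewrite !linearZ/= tinvK// chi1// scale1r.
- by move=> q a Wq; rewrite chi1// scale1r tinvK//; exact: WU.
move=> s; have sc a : smooth_on setT (fun q => chi q * triv j q (s q) 0 a).
  apply: cutoff_smooth (oU j) openT cK KU chi0 _; rewrite setIT.
  by apply sE; exact: section_smooth.
by exists (fun a => mkCinf (sc a)) => q a Wq /=; rewrite chi1// mul1r.
Qed.

Definition scale_section (f : Cinf M) (s : Gamma E) : Gamma E := scaleGamma_add f s 0.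

Lemma scale_sectionE f s p : scale_section f s p = f p *: s p.
Proof. by rewrite /= addr0. Qed.

Lemma Gamma_sumE (I : Type) (t : seq I) (P : pred I) (F : I -> Gamma E) p :
  (\sum_(i <- t | P i) F i) p = \sum_(i <- t | P i) F i p.
Proof. by elim/big_rec2: _ => // i _ y _ <-; rewrite GammaDE. Qed.

Lemma extend_vector p (v : E p) : exists s : Gamma E, s p = v.
Proof.
have [W [e [co [_ Wp span _ _]]]] := local_frame p.
exists (\sum_a scale_section (constC M (co p v 0 a)) (e a)).
rewrite Gamma_sumE [RHS](span p v Wp); apply: eq_bigr => a _.
by rewrite scale_sectionE.
Qed.

(** With chi a bump function at p and c_a the coordinates of s in a frame e_a,
    s = (1 - chi) s + \sum_a chi c_a e_a: the coefficients are global and all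
    vanish at p. *)
Lemma vanishing_section (s : Gamma E) p : s p = 0 ->
  exists (I : finType) (f : I -> Cinf M) (t : I -> Gamma E),
    (forall i, f i p = 0) /\ s = \sum_i scale_section (f i) (t i).
Proof.
move=> sp; have [W [e [co [oW Wp span _ /(_ s)[c cE]]]]] := local_frame p.
have [chi [[W' [_ W'p chi1]] [K [cK KW chi0]]]] := exists_bump oW Wp.
exists (unit + 'I_r)%type,
  (fun i => if i is inr a then chi * c a else 1 - chi),
  (fun i => if i is inr a then e a else s); split.
  case=> [_|a]; first by rewrite CinfDE CinfNE chi1// subrr.
  by rewrite CinfME cE// sp linear0 mxE mulr0.
apply: GammaP => q; rewrite Gamma_sumE big_sumType.
rewrite [X in _ = X + _](big_pred1 tt) ?scale_sectionE; last by case.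
have -> : \sum_a scale_section (chi * c a) (e a) q = chi q *: s q.
  have [Kq|nKq] := pselect (K q); last first.
    rewrite chi0// scale0r big1// => a _; rewrite scale_sectionE CinfME chi0//.
    by rewrite mul0r scale0r.
  rewrite [in RHS](span q (s q) (KW q Kq)) scaler_sumr; apply: eq_bigr => a _.
  by rewrite scale_sectionE CinfME cE ?scalerA//; exact: KW.
by rewrite -scalerDl CinfDE CinfNE Cinf1E subrK scale1r.
Qed.

End Frames.

(** * Matrices of smooth functions *)

Section Evaluation.
Variables (R : realType) (n : nat) (M : manifold R n).

Definition eval_at (q : M) (f : Cinf M) : R := f q.

Fact eval_at_zmod q : zmod_morphism (eval_at q). Proof. by []. Qed.
Fact eval_at_monoid q : monoid_morphism (eval_at q). Proof. by []. Qed.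

HB.instance Definition _ q :=
  GRing.isZmodMorphism.Build (Cinf M) R (eval_at q) (eval_at_zmod q).
HB.instance Definition _ q :=
  GRing.isMonoidMorphism.Build (Cinf M) R (eval_at q) (eval_at_monoid q).

Definition mx_at r (q : M) (G : 'M[Cinf M]_r) : 'M[R]_r := map_mx (eval_at q) G.

(** Cramer's rule: the inverse is a quotient of smooth functions. *)
Lemma inverse_matrix_germ r (G : 'M[Cinf M]_r) p : mx_at p G \in unitmx ->
  exists (H : 'M[Cinf M]_r) (W : set M), [/\ open W, W p &
    forall q, W q -> mx_at q G \in unitmx /\ mx_at q H = invmx (mx_at q G)].
Proof.
have detE q : \det (mx_at q G) = (\det G) q by rewrite /mx_at det_map_mx.
rewrite unitmxE unitfE detE => /inverse_germ[h [W [oW Wp hW]]].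
exists (h *: \adj G), W; split=> // q /hW[d0 hE].
have Gu : mx_at q G \in unitmx by rewrite unitmxE unitfE detE.
split=> //; rewrite /invmx Gu detE -hE /mx_at map_mxZ map_mx_adj.
by [].
Qed.

End Evaluation.

(** * Duality for the pairing of an algebroid *)

Section Musical.
Variables (R : realType) (n : nat) (M : manifold R n) (A : algebroid M).
Implicit Types (p q : M).

Lemma apairDl p (u v w : A p) : apair (u + v) w = apair u w + apair v w.
Proof. by have := apair_linear w 1 u v; rewrite !scale1r. Qed.
Lemma apair0l p (w : A p) : apair 0 w = 0.
Proof. by apply: (@addrI _ (apair 0 w)); rewrite -apairDl !addr0. Qed.
Lemma apairZl p k (u w : A p) : apair (k *: u) w = k * apair u w.
Proof. by have := apair_linear w k u 0; rewrite !addr0 apair0l addr0. Qed.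
Lemma apairNl p (u w : A p) : apair (- u) w = - apair u w.
Proof. by rewrite -scaleN1r apairZl mulN1r. Qed.
Lemma apairDr p (u v w : A p) : apair u (v + w) = apair u v + apair u w.
Proof. by rewrite apair_sym apairDl ![apair _ u]apair_sym. Qed.
Lemma apairZr p k (u v : A p) : apair u (k *: v) = k * apair u v.
Proof. by rewrite apair_sym apairZl [apair _ u]apair_sym. Qed.
Lemma apairNr p (u v : A p) : apair u (- v) = - apair u v.
Proof. by rewrite apair_sym apairNl [apair _ u]apair_sym. Qed.
Lemma apair_suml p (I : finType) (F : I -> A p) w :
  apair (\sum_i F i) w = \sum_i apair (F i) w.
Proof.
by apply: (big_morph (fun u => apair u w)) => [u v|]; rewrite ?apairDl ?apair0l.
Qed.

Lemma apair_ext p (u v : A p) : (forall w, apair u w = apair v w) -> u = v.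
Proof.
move=> uv; apply/eqP; rewrite -subr_eq0; apply/eqP/apair_nondegenerate => w.
by rewrite apairDl apairNl uv subrr.
Qed.

Section Frame.
Variables (r : nat) (p : M) (e : 'I_r -> A p) (co : {linear A p -> 'rV[R]_r}).
Hypotheses (spane : forall v, v = \sum_a co v 0 a *: e a)
  (coe : forall a, co (e a) = delta_mx 0 a).

Definition gram : 'M[R]_r := \matrix_(a, b) apair (e a) (e b).

(** A row vector killed by the Gram matrix is the coordinate vector of an
    element orthogonal to the whole fibre. *)
Lemma gram_unit : gram \in unitmx.
Proof.
rewrite -row_free_unit; apply: inj_row_free => u uG.
have : \sum_a u 0 a *: e a = 0.
  apply: apair_nondegenerate => w.
  have E b : apair (\sum_a u 0 a *: e a) (e b) = 0.
    have /matrixP/(_ 0 b) := uG; rewrite !mxE => uGb.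
    by rewrite -[RHS]uGb apair_suml; apply: eq_bigr => a _; rewrite apairZl mxE.
  rewrite (spane w) apair_sym apair_suml big1// => b _.
  by rewrite apairZl apair_sym E mulr0.
move=> /(congr1 co); rewrite linear0 linear_sum => <-.
by rewrite [LHS]row_sum_delta; apply: eq_bigr => a _; rewrite linearZ/= coe.
Qed.

(** The coordinates of the element representing lam solve a linear system whose
    matrix is the Gram matrix of the frame. *)
Lemma frame_represent (lam : A p -> R) : linear (lam : A p -> R^o) ->
  forall w, apair (\sum_a (\row_b lam (e b) *m invmx gram) 0 a *: e a) w = lam w.
Proof.
move=> lin_lam w; set c := _ *m _.
have lam0 : lam 0 = 0.
  by have := lin_lam (-1) 0 0; rewrite scaler0 addr0 scaleN1r addNr.
have lamE k u v : lam (k *: u + v) = k * lam u + lam v by rewrite lin_lam.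
have E b : apair (\sum_a c 0 a *: e a) (e b) = lam (e b).
  have : (c *m gram) 0 b = lam (e b) by rewrite /c mulmxKV ?gram_unit// mxE.
  rewrite mxE => <-; rewrite apair_suml; apply: eq_bigr => a _.
  by rewrite apairZl [gram _ _]mxE.
have lam_sum (k : 'I_r -> R) :
    lam (\sum_a k a *: e a) = \sum_a k a * lam (e a).
  elim/big_rec2: _ => [|a x y _ xy]; first by rewrite lam0.
  by rewrite lamE xy.
have [k ->] : exists k : 'I_r -> R, w = \sum_a k a *: e a.
  by exists (co w 0); exact: spane.
rewrite lam_sum apair_sym apair_suml.
by apply: eq_bigr => a _; rewrite apairZl apair_sym E.
Qed.

End Frame.

Variable r : nat.
Hypothesis vA : is_vector_bundle_of_rank A r.

Lemma apair_represent p (lam : A p -> R) : linear (lam : A p -> R^o) ->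
  exists e, forall w, apair e w = lam w.
Proof.
have [W [e [co [_ Wp span coe _]]]] := local_frame vA p => lin_lam.
have := frame_represent (fun v => span p v Wp) (fun a => coe p a Wp) lin_lam.
by move=> h; eexists; exact: h.
Qed.

(** A section is smooth as soon as its pairings with smooth sections are: in a
    local frame its coordinates are obtained from these pairings by the inverse
    Gram matrix, whose entries are smooth. *)
Lemma smooth_section_dual (s : forall p, A p) :
  (forall b : Gamma A, smooth_on setT (fun p => apair (s p) (b p))) ->
  @smooth_section _ _ _ A s.
Proof.
move=> ss; apply: (smooth_section_local vA) => p.
have [W [e [co [oW Wp span coe _]]]] := local_frame vA p.
pose G : 'M[Cinf M]_r := \matrix_(a, b) ip (e a) (e b).
have GE q : mx_at q G = gram (fun a => e a q).
  by apply/matrixP => a b; rewrite !mxE.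
have : mx_at p G \in unitmx.
  by rewrite GE; exact: gram_unit (fun v => span p v Wp) (fun a => coe p a Wp).
move=> /inverse_matrix_germ[H [W' [oW' W'p HW]]].
pose l b : Cinf M := mkCinf (ss (e b)).
exists (W `&` W'), (\sum_a scale_section (\sum_b l b * H b a) (e a)); split=> //.
  exact: openI.
move=> q [Wq W'q]; have [_ HE] := HW q W'q.
have lin_lam : linear ((fun v => apair (s q) v) : A q -> R^o).
  by move=> k u v; rewrite apairDr apairZr.
have := frame_represent (fun v => span q v Wq) (fun a => coe q a Wq) lin_lam.
move=> lamE; apply: apair_ext => w; rewrite -lamE; congr (apair _ w).
rewrite Gamma_sumE; apply: eq_bigr => a _; rewrite scale_sectionE; congr (_ *: _).
rewrite -GE -HE mxE Cinf_sumE; apply: eq_bigr => b _.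
by rewrite !mxE.
Qed.

End Musical.

(** * Dual bases of a tangent space *)

Section TangentAlgebra.
Variables (R : realType) (n : nat) (M : manifold R n) (p : M).
Implicit Types (u v w : tangent p) (f g : Cinf M) (al : cotangent p).

Lemma tangentP u v : (forall f, u f = v f) -> u = v.
Proof. by move=> uv; apply/val_inj/funext. Qed.
Lemma tangentDE u v f : (u + v) f = u f + v f. Proof. by []. Qed.
Lemma tangentNE u f : (- u) f = - u f. Proof. by []. Qed.
Lemma tangentZE k u f : (k *: u) f = k * u f. Proof. by []. Qed.
Lemma tangent_sumE (I : Type) (r : seq I) (P : pred I) (F : I -> tangent p) f :
  (\sum_(i <- r | P i) F i) f = \sum_(i <- r | P i) F i f.
Proof. by elim/big_rec2: _ => // i _ y _ <-. Qed.

Lemma tangentD u f g : u (f + g) = u f + u g.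
Proof. by have := tangent_linear u 1 f g; rewrite !scale1r. Qed.
Lemma tangent0 u : u 0 = 0.
Proof. by apply: (@addrI _ (u 0)); rewrite -tangentD !addr0. Qed.
Lemma tangentZ u k f : u (k *: f) = k * u f.
Proof. by have := tangent_linear u k f 0; rewrite !addr0 tangent0 addr0. Qed.
Lemma tangentN u f : u (- f) = - u f.
Proof. by rewrite -scaleN1r tangentZ mulN1r. Qed.
Lemma tangent_sum u (I : Type) (r : seq I) (P : pred I) (F : I -> Cinf M) :
  u (\sum_(i <- r | P i) F i) = \sum_(i <- r | P i) u (F i).
Proof. by apply: big_morph; [exact: tangentD|exact: tangent0]. Qed.

Lemma cotangentP (al be : cotangent p) : (forall v, al v = be v) -> al = be.
Proof. by move=> ab; apply/val_inj/funext. Qed.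
Lemma cotangentDE (al be : cotangent p) v : (al + be) v = al v + be v.
Proof. by []. Qed.
Lemma cotangentNE al v : (- al) v = - al v. Proof. by []. Qed.
Lemma cotangentD al u v : al (u + v) = al u + al v.
Proof. by have := cotangent_linear al 1 u v; rewrite !scale1r. Qed.
Lemma cotangentZ al k v : al (k *: v) = k * al v.
Proof. by have := cotangent_linear al k v 0; rewrite !addr0 cotangent0 addr0. Qed.
Lemma cotangentN al v : al (- v) = - al v.
Proof. by rewrite -scaleN1r cotangentZ mulN1r. Qed.
Lemma cotangent_sum al (I : Type) (r : seq I) (P : pred I)
    (F : I -> tangent p) :
  al (\sum_(i <- r | P i) F i) = \sum_(i <- r | P i) al (F i).
Proof. by apply: big_morph; [exact: cotangentD|exact: cotangent0]. Qed.

(** Tangent vectors are functionals on smooth functions, so that a basis of the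
    tangent space can be paired with functions having the dual differentials. *)
Definition dual_basis m (v : 'I_m -> tangent p) (f : 'I_m -> Cinf M) : Prop :=
  (forall i j, v i (f j) = (i == j)%:R) /\
  forall w, w = \sum_i w (f i) *: v i.

(** Gram-Schmidt, one vector at a time: subtract from u its components along
    the v_i already found; if the rest u' is nonzero, some function detects it,
    and that function is corrected to be annihilated by the v_i. *)
Lemma dual_family (us : seq (tangent p)) :
  exists m (v : 'I_m -> tangent p) (f : 'I_m -> Cinf M),
    (forall i j, v i (f j) = (i == j)%:R) /\
    forall u, u \in us -> u = \sum_i u (f i) *: v i.
Proof.
elim: us => [|u us [m [v [f [vf usE]]]]].
  by exists 0, (fun=> 0), (fun=> 0); split=> // -[].
have [u' u'E] : exists u', u' = u - \sum_i u (f i) *: v i by eexists.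
have [u'0|u'0] := eqVneq u' 0.
  exists m, v, f; split=> // w; rewrite inE => /orP[/eqP ->|]; last exact: usE.
  by apply/eqP; rewrite -subr_eq0 -u'E; exact/eqP.
have [g u'g] : exists g, u' g != 0.
  apply: contrapT => /forallNP h; case/eqP: u'0; apply: tangentP => g.
  by have /negP/negPn/eqP := h g.
have u'f j : u' (f j) = 0.
  rewrite u'E tangentDE tangentNE tangent_sumE.
  under eq_bigr do rewrite tangentZE vf.
  rewrite (bigD1 j)//= eqxx big1 => [|i /negbTE->]; last by rewrite mulr0.
  by rewrite addr0 mulr1 subrr.
pose g' := (u' g)^-1 *: (g - \sum_i v i g *: f i).
have vg' i : v i g' = 0.
  rewrite tangentZ tangentD tangentN tangent_sum.
  under eq_bigr do rewrite tangentZ vf.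
  rewrite (bigD1 i)//= eqxx big1 => [|j /negbTE ji].
    by rewrite addr0 mulr1 subrr mulr0.
  by rewrite eq_sym ji mulr0.
have u'g' : u' g' = 1.
  rewrite tangentZ tangentD tangentN tangent_sum big1 ?subr0 ?mulVf//.
  by move=> j _; rewrite tangentZ u'f mulr0.
pose cons T (x : T) (s : 'I_m -> T) (i : 'I_m.+1) :=
  if unlift ord0 i is Some j then s j else x.
have cons0 T x s : @cons T x s ord0 = x by rewrite /cons unlift_none.
have consS T x s j : @cons T x s (lift ord0 j) = s j by rewrite /cons liftK.
exists m.+1, (cons _ u' v), (cons _ g' f); split=> [i j|w].
  case: (unliftP ord0 i) => [i'|] ->; case: (unliftP ord0 j) => [j'|] ->;
    rewrite ?cons0 ?consS.
  - by rewrite vf (inj_eq lift_inj).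
  - by rewrite vg' eq_sym (negbTE (neq_lift _ _)).
  - by rewrite u'f (negbTE (neq_lift _ _)).
  - by rewrite u'g' eqxx.
rewrite inE big_ord_recl !cons0 => wus.
transitivity (w g' *: u' + \sum_i w (f i) *: v i); last first.
  by congr (_ + _); apply: eq_bigr => i _; rewrite !consS.
case/orP: wus => [/eqP ->|/usE wE].
  have -> : u g' = 1.
    have -> : u = u' + \sum_i u (f i) *: v i by rewrite u'E subrK.
    rewrite tangentDE u'g' tangent_sumE big1 ?addr0// => i _.
    by rewrite tangentZE vg' mulr0.
  by rewrite scale1r u'E subrK.
have -> : w g' = 0; last by rewrite scale0r add0r.
by rewrite wE tangent_sumE big1// => i _; rewrite tangentZE vg' mulr0.
Qed.

(** Let Q and V be the matrices of the [X i (f k)] and of the [v k (g j)]. Then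
    B = Q V. As Q is square, B invertible forces Q invertible, which expresses
    the basis v in terms of X: m vectors separated by m functions span an
    m-dimensional space. *)
Lemma dual_basis_change m (v : 'I_m -> tangent p) (f : 'I_m -> Cinf M)
    (X : 'I_m -> tangent p) (g : 'I_m -> Cinf M) : dual_basis v f ->
  let B := \matrix_(i, j) (X i (g j) : R) in B \in unitmx ->
  forall w, w = \sum_k (\row_j (w (g j) : R) *m invmx B) 0 k *: X k.
Proof.
move=> [vf span] B Bu w.
pose Q := \matrix_(i, k) (X i (f k) : R); pose V := \matrix_(k, j) (v k (g j) : R).
have BQV : B = Q *m V.
  apply/matrixP => i j; rewrite !mxE [in LHS](span (X i)) tangent_sumE.
  by apply: eq_bigr => k _; rewrite !mxE tangentZE.
have Qu : Q \in unitmx by move: Bu; rewrite BQV unitmx_mul => /andP[].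
have vX k : v k = \sum_i invmx Q k i *: X i.
  have QE l : \sum_i invmx Q k i * X i (f l) = (k == l)%:R.
    have /matrixP/(_ k l) := mulVmx Qu; rewrite !mxE => <-.
    by apply: eq_bigr => i _; rewrite !mxE.
  transitivity (\sum_l (\sum_i invmx Q k i * X i (f l)) *: v l).
    under eq_bigr do rewrite QE.
    rewrite (bigD1 k)//= eqxx scale1r big1 ?addr0// => l /negbTE lk.
    by rewrite eq_sym lk scale0r.
  under eq_bigr do rewrite scaler_suml.
  rewrite exchange_big /=; apply: eq_bigr => i _.
  rewrite [in RHS](span (X i)) scaler_sumr; apply: eq_bigr => l _.
  by rewrite scalerA.
have [c wE] : exists c : 'rV[R]_m, w = \sum_i c 0 i *: X i.
  exists (\row_k (w (f k) : R) *m invmx Q); rewrite {1}(span w).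
  under eq_bigr do rewrite vX scaler_sumr; rewrite exchange_big /=.
  apply: eq_bigr => i _; rewrite mxE scaler_suml; apply: eq_bigr => k _.
  by rewrite mxE scalerA.
suff <- : c = \row_j (w (g j) : R) *m invmx B by [].
rewrite -[LHS](mulmxK Bu); congr (_ *m _); apply/rowP => j.
rewrite !mxE wE tangent_sumE; apply: eq_bigr => i _.
by rewrite !mxE tangentZE.
Qed.

End TangentAlgebra.

Definition pack_linear (R : realType) (U V : lmodType R) (f : U -> V)
  (lf : linear f) : {linear U -> V} :=
  HB.pack f (GRing.isLinear.Build R U V *:%R f lf).

(** * Splitting the anchor *)

Section Splitting.
Variables (R : realType) (n : nat) (M : manifold R n) (A : algebroid M).
Variable r : nat.
Hypotheses (vA : is_vector_bundle_of_rank A r) (exA : is_exact A).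
Implicit Types (p q : M).

Lemma anchorZ p k (e : A p) :
  anchor A p (k *: e) = k *: anchor A p e :> tangent p.
Proof. exact: linearZ. Qed.

Lemma anchor_form_linear p (al : cotangent p) :
  linear ((fun b => al (anchor A p b)) : A p -> R^o).
Proof. by move=> k u v; rewrite linearP cotangentD cotangentZ. Qed.

(** [rhostar] selects an element with this property if there is one, and
    nondegeneracy in a finite-dimensional fibre supplies it. *)
Lemma rhostarP p (al : cotangent p) w :
  apair (rhostar A al) w = al (anchor A p w).
Proof.
have [e eE] := apair_represent vA (anchor_form_linear al).
by rewrite /rhostar; case: xgetP => [e' _ -> //|/(_ e)].
Qed.

Lemma rhostar_eq p (al : cotangent p) e :
  (forall w, apair e w = al (anchor A p w)) -> e = rhostar A al.
Proof. by move=> eE; apply: apair_ext => w; rewrite eE rhostarP. Qed.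

Lemma anchor_rhostar p (al : cotangent p) : anchor A p (rhostar A al) = 0.
Proof. by have [_ /(_ (rhostar A al))[_ h] _] := exA p; apply: h; exists al. Qed.

Lemma ker_anchor p (e : A p) : anchor A p e = 0 -> exists al, e = rhostar A al.
Proof. by have [_ h _] := exA p; move/h. Qed.

Lemma anchor_onto p (v : tangent p) : exists e : A p, anchor A p e = v.
Proof. by have [_ _] := exA p; exact. Qed.

(** The tangent space at p is spanned by the anchors of a frame, hence it is
    finite-dimensional. *)
Lemma exists_dual_basis p : exists m (v : 'I_m -> tangent p)
  (f : 'I_m -> Cinf M), dual_basis v f.
Proof.
have [W [e [co [_ Wp span _ _]]]] := local_frame vA p.
have [m [v [f [vf usE]]]] :=
  dual_family [seq anchor A p (e a p) | a <- enum 'I_r].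
exists m, v, f; split=> // w; have [x <-] := anchor_onto w.
rewrite (span p x Wp) linear_sum.
transitivity (\sum_a co p x 0 a *: \sum_i (anchor A p (e a p) (f i)) *: v i).
  apply: eq_bigr => a _; rewrite linearZ/= -usE//.
  by apply/mapP; exists a => //; rewrite mem_enum.
under eq_bigr do rewrite scaler_sumr; rewrite exchange_big /=.
apply: eq_bigr => i _; rewrite tangent_sumE scaler_suml; apply: eq_bigr => a _.
by rewrite anchorZ tangentZE scalerA.
Qed.

(** Exactness makes the fibre of A at p an extension of the tangent space by its
    dual. Concretely, the rho^* df_j and lifts a_i of the v_i form a basis: they
    span because ker rho is the image of rho^*, and they are independent because
    their Gram matrix is [[0, 1], [1, *]]. Hence the tangent spaces of M all
    have the same dimension, half of the rank of A. *)
Lemma dual_basis_rank p m (v : 'I_m -> tangent p) (f : 'I_m -> Cinf M) :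
  dual_basis v f -> (m + m)%N = r.
Proof.
move=> [vf span]; have [W [e [co [_ Wp spane coe _]]]] := local_frame vA p.
have co_inj x : co p x = 0 -> x = 0.
  move=> x0; rewrite (spane p x Wp) x0 big1// => a _; by rewrite mxE scale0r.
pose th j : A p := rhostar A (differential_at (f j) p).
pose a i : A p := projT1 (cid (anchor_onto (v i))).
have aE i : anchor A p (a i) = v i by rewrite /a; case: cid.
pose N := col_mx (\matrix_(i, k) co p (th i) 0 k) (\matrix_(i, k) co p (a i) 0 k).
have NE (u1 u2 : 'rV[R]_m) : row_mx u1 u2 *m N =
    co p (\sum_i u1 0 i *: th i + \sum_i u2 0 i *: a i).
  rewrite mul_row_col linearD; congr (_ + _); rewrite linear_sum;
    apply/rowP => k; rewrite mxE summxE; apply: eq_bigr => i _;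
    by rewrite linearZ/= !mxE.
have free : row_free N.
  apply: inj_row_free => u; rewrite -(hsubmxK u); move: (lsubmx u) (rsubmx u).
  move=> u1 u2; rewrite NE => /co_inj E.
  have thE j w : apair (th j) w = anchor A p w (f j) by rewrite rhostarP.
  have u2E j : u2 0 j = 0.
    have := congr1 (fun x => apair x (th j)) E; rewrite /= apair0l => <-.
    rewrite apairDl !apair_suml.
    rewrite [X in _ = X + _]big1 ?add0r => [|i _]; last first.
      by rewrite apairZl thE anchor_rhostar mulr0.
    under eq_bigr do rewrite apairZl apair_sym thE aE vf.
    rewrite (bigD1 j)//= eqxx mulr1 big1 ?addr0// => i /negbTE ->.
    by rewrite mulr0.
  have u1E j : u1 0 j = 0.
    have := congr1 (fun x => apair x (a j)) E; rewrite /= apair0l => <-.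
    rewrite apairDl !apair_suml.
    rewrite [X in _ = _ + X]big1 ?addr0 => [|i _]; last first.
      by rewrite apairZl u2E mul0r.
    under eq_bigr do rewrite apairZl thE aE vf.
    rewrite (bigD1 j)//= eqxx mulr1 big1 ?addr0// => i /negbTE ij.
    by rewrite eq_sym ij mulr0.
  by apply/rowP => k; rewrite mxE [RHS]mxE; case: splitP => j _; rewrite ?u1E ?u2E.
have full : row_full N.
  rewrite -sub1mx; apply/row_subP => k; rewrite row1 -(coe p k Wp).
  set x := e k p; apply/submxP.
  have [al xal] : exists al, x - \sum_i anchor A p x (f i) *: a i = rhostar A al.
    apply: ker_anchor; rewrite linearB linear_sum/= {1}(span (anchor A p x)).
    apply/eqP; rewrite subr_eq0; apply/eqP; apply: eq_bigr => i _.
    by rewrite linearZ/= aE.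
  exists (row_mx (\row_i (al (v i) : R)) (\row_i (anchor A p x (f i) : R))).
  rewrite NE; congr (co p _); rewrite -[LHS](subrK (\sum_i anchor A p x (f i) *: a i)).
  congr (_ + _); last by apply: eq_bigr => i _; rewrite mxE.
  rewrite xal; apply/esym/rhostar_eq => w; rewrite apair_suml.
  rewrite [in RHS](span (anchor A p w)) cotangent_sum; apply: eq_bigr => i _.
  by rewrite apairZl rhostarP cotangentZ mxE mulrC.
by rewrite -(eqP free); exact/eqP.
Qed.

(** A splitting of the anchor where chi = 1. *)
Definition partial_splitting (L : bundle_morphism (TM M) A) (chi : Cinf M) :
  Prop := forall q (v : tangent q), anchor A q (L q v) = chi q *: v.

(** Let v_i, f_j be a dual basis at p and let a_i be sections of A whose anchors
    extend the v_i. The matrix B of the rho(a_i) f_j is the identity at p, hence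
    invertible near p. There the rho(a_i) are a frame, since the dimension of
    the tangent spaces is constant, and the components of a tangent vector w in
    that frame are the entries of (w f_j) B^-1. *)
Lemma local_splitting p : exists L (chi : Cinf M) (W : set M),
  [/\ open W, W p, forall q, W q -> chi q = 1 & partial_splitting L chi].
Proof.
have [m [v [f vf]]] := exists_dual_basis p.
have aP i : exists a : Gamma A, anchor A p (a p) = v i.
  by have [x <-] := anchor_onto (v i); have [a <-] := extend_vector vA x; exists a.
pose a i : Gamma A := projT1 (cid (aP i)).
have aE i : anchor A p (a i p) = v i by rewrite /a; case: cid.
pose B : 'M[Cinf M]_m := \matrix_(i, j) act (rho (a i)) (f j).
have /inverse_matrix_germ[H [W [oW Wp HW]]] : mx_at p B \in unitmx.
  suff -> : mx_at p B = 1%:M by exact: unitmx1.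
  by apply/matrixP => i j; rewrite !mxE /eval_at /= aE vf.1.
have [chi [[W' [oW' W'p chi1]] [K [cK KW chi0]]]] := exists_bump oW Wp.
pose L0 q (w : tangent q) : A q :=
  \sum_k (\sum_j w (f j) * (chi * H j k) q) *: a k q.
have L0lin q : linear (@L0 q).
  move=> c x y; rewrite /L0 scaler_sumr -big_split; apply: eq_bigr => k _.
  rewrite [RHS]/= scalerA -scalerDl; congr (_ *: _); rewrite mulr_sumr -big_split.
  apply: eq_bigr => j _.
  have E (x1 y1 z : R) : (c * x1 + y1) * z = c * (x1 * z) + y1 * z by ring.
  exact: E (x (f j)) (y (f j)) ((chi * H j k) q).
pose Lq q : {linear tangent q -> A q} := pack_linear (L0lin q).
have Ls (X : Gamma (TM M)) : smooth_section (fun q => Lq q (X q)).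
  have := section_smooth
    (\sum_k scale_section (\sum_j act X (f j) * (chi * H j k)) (a k)).
  congr smooth_section; apply: functional_extensionality_dep => q.
  rewrite Gamma_sumE; apply: eq_bigr => k _; rewrite scale_sectionE; congr (_ *: _).
  by rewrite Cinf_sumE; apply: eq_bigr => j _.
exists (BundleMorphism Ls), chi, W'; split=> // q w /=.
have [Kq|nKq] := pselect (K q); last first.
  rewrite chi0// scale0r /L0 big1 ?linear0// => k _.
  by rewrite big1 ?scale0r// => j _; rewrite CinfME chi0// mul0r mulr0.
have [Bu HE] := HW q (KW q Kq).
have [m' [v' [f' vf']]] := exists_dual_basis q.
have mm : m = m'.
  apply: double_inj; rewrite -!addnn.
  by rewrite (dual_basis_rank vf) (dual_basis_rank vf').
subst m'.
have BE : mx_at q B = \matrix_(i, j) (anchor A q (a i q) (f j) : R).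
  by apply/matrixP => i j; rewrite !mxE.
rewrite BE in Bu HE.
rewrite [in RHS](dual_basis_change vf' Bu w) /L0 linear_sum scaler_sumr.
apply: eq_bigr => k _; rewrite linearZ/= scalerA; congr (_ *: _).
rewrite -HE mxE mulr_sumr; apply: eq_bigr => j _; rewrite !mxE.
exact: (@mulrCA R (w (f j)) (chi q) (H j k q)).
Qed.

Definition comb_morphism (E F : bundle M) (f : Cinf M) (P Q : bundle_morphism E F) :
  bundle_morphism E F.
Proof.
exists (fun q => (f q \*: P q \+ Q q : E q -> F q) : {linear E q -> F q}).
by move=> a; exact: section_smooth (scaleGamma_add f (push P a) (push Q a)).
Defined.

Lemma comb_morphismE (E F : bundle M) f (P Q : bundle_morphism E F) q v :
  comb_morphism f P Q q v = f q *: P q v + Q q v.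
Proof. by []. Qed.

Definition zero_morphism (E F : bundle M) : bundle_morphism E F.
Proof.
exists (fun q => (\0 : E q -> F q) : {linear E q -> F q}).
by move=> a; exact: smooth_section0.
Defined.

(** Partial splittings (L_N, chi_N) indexed by a countable basis are glued by
    S_(N+1) = S_N + (1 - tau_N) L_N and tau_(N+1) = tau_N + (1 - tau_N) chi_N,
    so that rho S_N = tau_N. Once tau_N = 1 at a point the sequence is
    stationary there, and every point has a neighbourhood on which some tau_N is
    1: the limit is locally one of the S_N, hence smooth. This plays the part of
    a partition of unity, with local finiteness built in. *)
Lemma splitting : exists s : bundle_morphism (TM M) A,
  forall q (v : tangent q), anchor A q (s q v) = v.
Proof.
have [B cB [Bopen Bbase]] := @manifold_second_countable _ _ M.
have [phi phi_inj] : exists phi : set M -> nat, {in B &, injective phi}.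
  by move: cB => /countable_injP [phi]; exists phi.
pose adapted V := exists L (chi : Cinf M),
  partial_splitting L chi /\ forall q, V q -> chi q = 1.
(* One partial splitting for each basic open set that admits one; the indices
   of the other basic open sets get the zero morphism, which leaves the partial
   sums S below unchanged. *)
have LP N : exists L (chi : Cinf M), partial_splitting L chi /\
    forall V, B V -> phi V = N -> adapted V -> forall q, V q -> chi q = 1.
  have [[V [BV VN [L [chi [Lchi chi1]]]]]|no] :=
      pselect (exists V, [/\ B V, phi V = N & adapted V]).
    exists L, chi; split=> // V' BV' V'N _ q V'q; apply: chi1.
    by rewrite (phi_inj V V') ?inE// V'N.
  exists (zero_morphism (TM M) A), 0; split=> [q v|V BV VN ex].
    by rewrite linear0 scale0r.
  by case: no; exists V.
pose L N := projT1 (cid (LP N)).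
have LP2 N := projT2 (cid (LP N)); rewrite -/(L _) in LP2.
pose chi N := projT1 (cid (LP2 N)).
have chiP N := projT2 (cid (LP2 N)); rewrite -/(chi _) in chiP.
pose fix S N : bundle_morphism (TM M) A * Cinf M :=
  if N is N'.+1 then
    (comb_morphism (1 - (S N').2) (L N') (S N').1,
     (S N').2 + (1 - (S N').2) * chi N')
  else (zero_morphism (TM M) A, 0).
have SE N q (v : tangent q) : anchor A q ((S N).1 q v) = (S N).2 q *: v.
  elim: N => [|N IH]; first by rewrite /= linear0 scale0r.
  rewrite [(S N.+1).1]/= [(S N.+1).2]/= linearD linearZ/= IH (chiP N).1.
  by rewrite scalerA -scalerDl addrC.
have stay N N' q : (S N).2 q = 1 -> (N <= N')%N ->
    (S N').2 q = 1 /\ forall v : tangent q, (S N').1 q v = (S N).1 q v.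
  move=> SN; elim: N' => [|N' IH]; first by rewrite leqn0 => /eqP <-.
  rewrite leq_eqVlt => /orP[/eqP <- //|/IH[S1 Sv]]; split=> [|v].
    rewrite [(S N'.+1).2]/= CinfDE CinfME CinfDE CinfNE S1 subrr mul0r.
    by rewrite addr0.
  by rewrite [(S N'.+1).1]/= comb_morphismE CinfDE CinfNE S1 subrr scale0r add0r.
have cover q : exists N W, [/\ open W, W q & forall q', W q' -> (S N).2 q' = 1].
  have [L' [chi' [W [oW Wq chi1 L'E]]]] := local_splitting q.
  have [V [BV Vq] VW] : filter_from [set U | B U /\ U q] id W.
    by apply: Bbase; exact: open_nbhs_nbhs.
  exists (phi V).+1, V; split=> //; first exact: Bopen.
  move=> q' Vq'; rewrite [(S _).2]/=.
  rewrite CinfDE CinfME ((chiP (phi V)).2 V BV erefl _ q' Vq').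
    by rewrite mulr1 CinfDE CinfNE addrC subrK.
  by exists L', chi'; split=> // x /VW; exact: chi1.
pose N0 q := projT1 (cid (cover q)).
have N0P q : (S (N0 q)).2 q = 1.
  by rewrite /N0; case: cid => N /= [W [_ Wq WE]]; exact: WE.
have N0E N q : (S N).2 q = 1 ->
    forall v : tangent q, (S (N0 q)).1 q v = (S N).1 q v.
  move=> SN v; have [le|/ltnW le] := leqP (N0 q) N.
    by have [_ ->] := stay _ _ q (N0P q) le.
  by have [_ ->] := stay _ _ q SN le.
have ss (X : Gamma (TM M)) :
    smooth_section (fun q => (S (N0 q)).1 q (X q)).
  apply: (smooth_section_local vA) => q; have [N [W [oW Wq WE]]] := cover q.
  exists W, (push (S N).1 X); split=> // q' /WE SN; exact: (N0E _ _ SN (X q')).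
exists (@BundleMorphism _ _ _ (TM M) A (fun q => (S (N0 q)).1 q) ss) => q v.
by rewrite /= SE N0P scale1r.
Qed.

End Splitting.

(** * Tensorial operations on vector fields *)

Section Tensors.
Variables (R : realType) (n : nat) (M : manifold R n).
Implicit Types (X Y Z : Gamma (TM M)) (f g : Cinf M) (p q : M).

(** Linearity over the ring of smooth functions. *)
Definition tensorial (Phi : Gamma (TM M) -> Cinf M) : Prop :=
  forall f X Y, Phi (scaleGamma_add f X Y) = f * Phi X + Phi Y.

Lemma tensorialD Phi X Y : tensorial Phi -> Phi (X + Y) = Phi X + Phi Y.
Proof.
move=> tP; have c1 : constC M 1 = 1 by exact: CinfP.
by rewrite -[Phi X]mul1r -c1; exact: tP.
Qed.

Lemma tensorial0 Phi : tensorial Phi -> Phi 0 = 0.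
Proof. by move=> tP; apply: (@addrI _ (Phi 0)); rewrite -tensorialD// !addr0. Qed.

Lemma tensorial_sum Phi (I : finType) (F : I -> Gamma (TM M)) (f : I -> Cinf M) :
  tensorial Phi -> Phi (\sum_i scale_section (f i) (F i)) = \sum_i f i * Phi (F i).
Proof.
move=> tP; elim/big_rec2: _ => [|i X y _ <-]; first exact: tensorial0.
by rewrite tensorialD// [X in X + _]tP tensorial0// addr0.
Qed.

Lemma act0 X : act X 0 = 0.
Proof. by apply: CinfP => p; exact: tangent0. Qed.
Lemma actD X f g : act X (f + g) = act X f + act X g.
Proof. by apply: CinfP => p; exact: tangentD. Qed.
Lemma actM X f g : act X (f * g) = f * act X g + g * act X f.
Proof. by apply: CinfP => p; exact: tangent_leibniz. Qed.
Lemma act_scale f X Y g : act (scaleGamma_add f X Y) g = f * act X g + act Y g.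
Proof. by apply: CinfP. Qed.
Lemma lieE X Y f : act (lie X Y) f = act X (act Y f) - act Y (act X f).
Proof. by apply: CinfP. Qed.

Lemma vfP X Y : (forall f, act X f = act Y f) -> X = Y.
Proof.
move=> XY; apply: GammaP => p; apply: tangentP => f.
by have /(congr1 (fun g : Cinf M => g p)) := XY f.
Qed.

Lemma lie_antisym X Y : lie X Y = - lie Y X.
Proof.
apply: GammaP => p; rewrite GammaNE; apply: tangentP => f.
by rewrite tangentNE opprB.
Qed.

Lemma lie_scale f X Y Z : lie X (scaleGamma_add f Y Z) =
  scaleGamma_add f (lie X Y) (scaleGamma_add (act X f) Y (lie X Z)).
Proof.
apply: vfP => g; rewrite lieE !act_scale !lieE actD actM; ring.
Qed.

Lemma pairing1_tensorial (al : Omega1 M) : tensorial (pairing1 al).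
Proof.
by move=> f X Y; apply: CinfP => p; rewrite /= cotangentD cotangentZ.
Qed.

Lemma pairing1D (al : Omega1 M) X Y :
  pairing1 al (X + Y) = pairing1 al X + pairing1 al Y.
Proof. exact/tensorialD/pairing1_tensorial. Qed.

Lemma pairing1N (al : Omega1 M) X : pairing1 al (- X) = - pairing1 al X.
Proof. by apply: CinfP => p; rewrite -[LHS]/(al p ((- X) p)) GammaNE cotangentN. Qed.

(** The invariant formula for the exterior derivative of a 1-form. *)
Definition d1_formula (al : Omega1 M) X Y : Cinf M :=
  act X (pairing1 al Y) - act Y (pairing1 al X) - pairing1 al (lie X Y).

Lemma d1_formula_antisym al X Y : d1_formula al X Y = - d1_formula al Y X.
Proof. rewrite /d1_formula [lie Y X]lie_antisym pairing1N; ring. Qed.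

Lemma d1_formula_tensorial al X : tensorial (d1_formula al X).
Proof.
move=> f Y Z; rewrite /d1_formula lie_scale !pairing1_tensorial actD actM act_scale.
ring.
Qed.

End Tensors.

(** * From tensorial operations to differential forms *)

Section Descent.
Variables (R : realType) (n : nat) (M : manifold R n) (A : algebroid M).
Variable r : nat.
Hypothesis vA : is_vector_bundle_of_rank A r.
Variable s : bundle_morphism (TM M) A.
Hypothesis sK : forall q (v : tangent q), anchor A q (s q v) = v.
Implicit Types (X Y Z : Gamma (TM M)) (p q : M).

Lemma rho_push X : rho (push s X) = X.
Proof. by apply: GammaP => p; exact: sK. Qed.

(** Transported from A by the splitting: the section s X vanishes at p, and rho
    maps its decomposition to one of X. *)
Lemma vanishing_vf X p : X p = 0 ->
  exists (I : finType) (f : I -> Cinf M) (Y : I -> Gamma (TM M)),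
    (forall i, f i p = 0) /\ X = \sum_i scale_section (f i) (Y i).
Proof.
move=> Xp.
have [|I [f [t [fp tE]]]] := @vanishing_section _ _ _ _ _ vA (push s X) p.
  by rewrite /= Xp linear0.
exists I, f, (fun i => rho (t i)); split=> //.
rewrite -[LHS]rho_push tE; apply: GammaP => q; rewrite /= !Gamma_sumE.
by rewrite linear_sum; apply: eq_bigr => i _; rewrite !scale_sectionE linearZ.
Qed.

(** If X and Y agree at p then X - Y is a combination of vector fields with
    coefficients vanishing at p, and these coefficients come out of Phi. *)
Lemma tensorial_at Phi X Y p : tensorial Phi -> X p = Y p ->
  Phi X p = Phi Y p.
Proof.
move=> tP XY; have XYE : X = (X - Y) + Y by rewrite subrK.
have [|I [f [Z [fp ZE]]]] := @vanishing_vf (X - Y) p.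
  by rewrite GammaDE GammaNE XY subrr.
rewrite XYE tensorialD// ZE tensorial_sum// CinfDE Cinf_sumE big1 ?add0r// => i _.
by rewrite CinfME fp mul0r.
Qed.

Lemma extend_tangent p (v : tangent p) : exists X, X p = v.
Proof.
have [a aE] := extend_vector vA (s p v).
by exists (rho a); rewrite /= aE sK.
Qed.

Definition extend_vf p (v : tangent p) : Gamma (TM M) :=
  projT1 (cid (extend_tangent v)).

Lemma extend_vfE p (v : tangent p) : extend_vf v p = v.
Proof. by rewrite /extend_vf; case: cid. Qed.

Lemma eq_opp_eq0 (x : R) : x = - x -> x = 0.
Proof. by lra. Qed.

Lemma tensorial_comb Phi p k (u v : tangent p) : tensorial Phi ->
  Phi (extend_vf (k *: u + v)) p = k * Phi (extend_vf u) p + Phi (extend_vf v) p.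
Proof.
move=> tP; rewrite (@tensorial_at Phi _ (scaleGamma_add (constC M k) (extend_vf u) (extend_vf v)))//.
  by rewrite tP.
by rewrite /= !extend_vfE.
Qed.

(** The form is evaluated on vectors by extending them to vector fields; by
    [tensorial_at] the result does not depend on the extensions. Antisymmetry
    carries tensoriality from one argument to the other. *)
Lemma form2_of_tensor (Phi : Gamma (TM M) -> Gamma (TM M) -> Cinf M) :
  (forall X Y, Phi X Y = - Phi Y X) -> (forall X, tensorial (Phi X)) ->
  exists w : Omega2 M, forall X Y p, w p (X p) (Y p) = Phi X Y p.
Proof.
move=> anti ten.
have tenl Y : tensorial (Phi^~ Y).
  by move=> f X Z; rewrite anti ten (anti X) (anti Z); ring.
pose W p (u v : tangent p) : R^o := Phi (extend_vf u) (extend_vf v) p.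
have WE X Y p : W p (X p) (Y p) = Phi X Y p.
  rewrite /W (tensorial_at (Y := Y) (ten _)) ?extend_vfE//.
  by rewrite (tensorial_at (Y := X) (tenl Y)) ?extend_vfE.
have Wl p (v : tangent p) : linear (fun u => W p u v).
  by move=> k u1 u2; exact: (tensorial_comb _ _ _ (tenl _)).
have Wr p (u : tangent p) : linear (W p u).
  by move=> k v1 v2; exact: (tensorial_comb _ _ _ (ten _)).
have Walt p (u : tangent p) : W p u u = 0.
  by apply: eq_opp_eq0; rewrite /W {1}anti.
have Ws X Y : @smooth_section _ _ _ (line M) (fun p => W p (X p) (Y p)).
  by apply: smooth_on_ext (Cinf_smooth (Phi X Y)) => p _; rewrite WE.
by exists (@Form2 _ _ _ (TM M) (line M) W Wl Wr Walt Ws).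
Qed.

Lemma form3_of_tensor
    (Phi : Gamma (TM M) -> Gamma (TM M) -> Gamma (TM M) -> Cinf M) :
  (forall X Y Z, Phi X Y Z = - Phi Y X Z) ->
  (forall X Y Z, Phi X Y Z = - Phi X Z Y) ->
  (forall X Y, tensorial (Phi X Y)) ->
  exists H : Omega3 M, forall X Y Z p, H p (X p) (Y p) (Z p) = Phi X Y Z p.
Proof.
move=> anti12 anti23 ten.
have ten2 X Z : tensorial (fun Y => Phi X Y Z).
  by move=> f Y Y'; rewrite anti23 ten (anti23 X Y) (anti23 X Y'); ring.
have ten1 Y Z : tensorial (fun X => Phi X Y Z).
  by move=> f X X'; rewrite anti12 ten2 (anti12 X Y) (anti12 X' Y); ring.
pose W p (u v w : tangent p) : R^o := Phi (extend_vf u) (extend_vf v) (extend_vf w) p.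
have WE X Y Z p : W p (X p) (Y p) (Z p) = Phi X Y Z p.
  rewrite /W (tensorial_at (Y := Z) (ten _ _)) ?extend_vfE//.
  rewrite (tensorial_at (Y := Y) (ten2 _ _)) ?extend_vfE//.
  by rewrite (tensorial_at (Y := X) (ten1 _ _)) ?extend_vfE.
have W1 p (v w : tangent p) : linear (fun u => W p u v w).
  by move=> k u1 u2; exact: (tensorial_comb _ _ _ (ten1 _ _)).
have W2 p (u w : tangent p) : linear (fun v => W p u v w).
  by move=> k v1 v2; exact: (tensorial_comb _ _ _ (ten2 _ _)).
have W3 p (u v : tangent p) : linear (W p u v).
  by move=> k w1 w2; exact: (tensorial_comb _ _ _ (ten _ _)).
have W12 p (u v : tangent p) : W p u u v = 0.
  by apply: eq_opp_eq0; rewrite /W {1}anti12.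
have W23 p (u v : tangent p) : W p u v v = 0.
  by apply: eq_opp_eq0; rewrite /W {1}anti23.
have Ws X Y Z : smooth_on setT (fun p => W p (X p) (Y p) (Z p)).
  by apply: smooth_on_ext (Cinf_smooth (Phi X Y Z)) => p _; rewrite WE.
by exists (Form3 W1 W2 W3 W12 W23 Ws).
Qed.

(** [d1 al] is selected by the invariant formula, so all that has to be shown is
    that the formula defines a 2-form. *)
Lemma d1E (al : Omega1 M) X Y p : d1 al p (X p) (Y p) = d1_formula al X Y p.
Proof.
have [w wE] := form2_of_tensor (d1_formula_antisym al) (d1_formula_tensorial al).
by rewrite /d1; case: xgetP => [w' _ ->//|/(_ w)].
Qed.

End Descent.

(** * Isotropic splittings *)

Section Isotropic.
Variables (R : realType) (n : nat) (M : manifold R n) (A : algebroid M).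
Variable r : nat.
Hypotheses (vA : is_vector_bundle_of_rank A r) (exA : is_exact A).
Implicit Types (p q : M).

Lemma rhostar_linear p : linear (@rhostar _ _ _ A p).
Proof.
move=> k al be; apply/esym/(rhostar_eq vA) => w.
by rewrite apairDl apairZl !(rhostarP vA).
Qed.

Lemma rhostar_smooth (al : Omega1 M) :
  @smooth_section _ _ _ A (fun p => rhostar A (al p)).
Proof.
apply: (smooth_section_dual vA) => b.
apply: smooth_on_ext (Cinf_smooth (pairing1 al (rho b))) => p _.
by rewrite (rhostarP vA).
Qed.

Definition rstar (al : Omega1 M) : Gamma A := MkGamma (rhostar_smooth al).

Lemma ip_rstar al b : ip (rstar al) b = pairing1 al (rho b).
Proof. by apply: CinfP => p; exact: (rhostarP vA (al p) (b p)). Qed.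

Lemma rho_rstar al : rho (rstar al) = 0.
Proof. by apply: GammaP => p; exact: (anchor_rhostar exA (al p)). Qed.

Section Form.
Variable s : bundle_morphism (TM M) A.

Fact pair_form_linear p (e : A p) :
  (fun w : tangent p => apair e (s p w)) \in @linear_form_on_tangent _ _ _ p.
Proof.
by apply/asboolP => k u v; rewrite linearP apairDr apairZr.
Qed.

(** The second component of the isomorphism: the 1-form Z |-> <e, s Z>. *)
Definition pair_form p (e : A p) : cotangent p :=
  MkCotangent (pair_form_linear e).

Lemma pair_form_is_linear p : linear (@pair_form p).
Proof.
by move=> k e e'; apply: cotangentP => w; rewrite /= apairDl apairZl.
Qed.

Lemma pair_form_smooth (a : Gamma A) :
  @smooth_section _ _ _ (TstarM M) (fun p => pair_form (a p)).
Proof. by move=> X; exact: Cinf_smooth (ip a (push s X)). Qed.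

End Form.

(** Replace s by s - 1/2 rho^* <s -, s ->: the correction lies in the isotropic
    subspace ker rho, so that it changes <s v, s w> by
    - 1/2 <s v, s w> - 1/2 <s w, s v>. *)
Lemma isotropic_splitting : exists s : bundle_morphism (TM M) A,
  (forall q (v : tangent q), anchor A q (s q v) = v) /\
  forall q (v w : tangent q), apair (s q v) (s q w) = 0.
Proof.
have [s sK] := splitting vA exA.
pose t0 q (v : tangent q) : A q :=
  s q v - 2^-1 *: rhostar A (pair_form s (s q v)).
have tlin q : linear (@t0 q).
  move=> k u v; rewrite /t0 linearP pair_form_is_linear rhostar_linear.
  rewrite !scalerDr !scalerN !opprD !scalerA [2^-1 * k]mulrC.
  by rewrite addrACA.
pose t q : {linear tangent q -> A q} := pack_linear (tlin q).
have ts (X : Gamma (TM M)) : smooth_section (fun q => t q (X q)).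
  pose be : Omega1 M := MkGamma (pair_form_smooth s (push s X)).
  have := section_smooth (push s X - 2^-1 *: rstar be).
  congr smooth_section; apply: functional_extensionality_dep => q.
  by rewrite GammaDE GammaNE GammaZE.
exists (@BundleMorphism _ _ _ (TM M) A t ts); split=> [q v|q v w].
  rewrite -[LHS]/(anchor A q (t0 q v)) linearB linearZ/= anchor_rhostar//.
  by rewrite scaler0 subr0 sK.
rewrite -[LHS]/(apair (t0 q v) (t0 q w)) /t0.
rewrite !(apairDl, apairDr, apairNl, apairNr, apairZl, apairZr).
rewrite [apair (s q v) (rhostar _ _)]apair_sym !(rhostarP vA) !sK.
rewrite anchor_rhostar// cotangent0 /= [apair (s q w) _]apair_sym.
have E (x : R) : x - 2^-1 * x + (- (2^-1 * x) - - (2^-1 * (2^-1 * 0))) = 0 by field.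
exact: E.
Qed.

End Isotropic.

(** * The standard form of an exact curved Courant algebroid *)

Section Form2Algebra.
Variables (R : realType) (n : nat) (M : manifold R n) (E F : bundle M).
Variables (w : form2 E F) (p : M).
Implicit Types u v x y : E p.

Lemma form2_Dl x y u : w p (x + y) u = w p x u + w p y u.
Proof. by have := form2_linearl w u 1 x y; rewrite !scale1r. Qed.

Lemma form2_Dr x y u : w p u (x + y) = w p u x + w p u y.
Proof. by have := form2_linearr w u 1 x y; rewrite !scale1r. Qed.

Lemma form2_antisym u v : w p u v = - w p v u.
Proof.
apply/eqP; rewrite -addr_eq0; apply/eqP.
by have := form2_alt w (u + v); rewrite form2_Dl !form2_Dr !form2_alt add0r addr0.
Qed.

End Form2Algebra.

Section StandardForm.
Variables (R : realType) (n : nat) (M : manifold R n) (A : algebroid M).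
Variable r : nat.
Hypotheses (vA : is_vector_bundle_of_rank A r) (exA : is_exact A).
Hypothesis bilA : (forall b : Gamma A, linear (fun a => abracket a b)) /\
  (forall a : Gamma A, linear (abracket a)).
Hypothesis symA : forall (a b : Gamma A) p,
  (abracket a b + abracket b a) p = rhostar A (d0 (ip a b) p).
Hypothesis invA : forall a b c : Gamma A,
  act (rho a) (ip b c) = ip (abracket a b) c + ip b (abracket a c).
Variable F : form2 A (TM M).
Hypothesis FE : forall a b : Gamma A, form2_ev F a b = curvature a b.
Hypothesis F0 : forall p (u v : A p), anchor A p u = 0 -> F p u v = 0.
Variable s : bundle_morphism (TM M) A.
Hypothesis sK : forall q (v : tangent q), anchor A q (s q v) = v.
Hypothesis s_iso : forall q (v w : tangent q), apair (s q v) (s q w) = 0.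
Implicit Types (a b c : Gamma A) (X Y Z : Gamma (TM M)) (al be : Omega1 M).

Local Notation rs := (rstar vA).
Local Notation sig := (push s).

Lemma bracketDl a b c : abracket (a + b) c = abracket a c + abracket b c.
Proof. by have := bilA.1 c 1 a b; rewrite !scale1r. Qed.
Lemma bracketDr a b c : abracket a (b + c) = abracket a b + abracket a c.
Proof. by have := bilA.2 a 1 b c; rewrite !scale1r. Qed.

Lemma bracket_flip a b : abracket a b = rs (d0 (ip a b)) - abracket b a.
Proof.
apply: (@addIr _ (abracket b a)); rewrite subrK.
by apply: GammaP => p; rewrite symA.
Qed.

Lemma ipDl a b c : ip (a + b) c = ip a c + ip b c.
Proof. by apply: CinfP => p; rewrite -[LHS]/(apair ((a + b) p) (c p)) GammaDE apairDl. Qed.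
Lemma ipNl a c : ip (- a) c = - ip a c.
Proof. by apply: CinfP => p; rewrite -[LHS]/(apair ((- a) p) (c p)) GammaNE apairNl. Qed.
Lemma ipC a b : ip a b = ip b a.
Proof. by apply: CinfP => p; exact: apair_sym. Qed.
Lemma ip_sig X Y : ip (sig X) (sig Y) = 0.
Proof. by apply: CinfP => p; exact: s_iso. Qed.

Lemma rho_bracket a b : rho (abracket a b) = lie (rho a) (rho b) + form2_ev F a b.
Proof. by rewrite FE /curvature addrC subrK. Qed.

(** The 2-form T of the standard bracket is the curvature of the anchor on
    horizontal vectors, T(X, Y) = F(s X, s Y). *)
Definition torsion : Omega2TM M.
Proof.
refine (@Form2 _ _ _ (TM M) (TM M) (fun p u v => F p (s p u) (s p v)) _ _ _ _).
- by move=> p v k u w; rewrite linearP form2_linearl.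
- by move=> p u k v w; rewrite linearP form2_linearr.
- by move=> p u; exact: form2_alt.
- by move=> X Y; exact: form2_smooth F (sig X) (sig Y).
Defined.

Lemma rho_bracket_sig X Y : rho (abracket (sig X) (sig Y)) = lieT torsion X Y.
Proof.
by rewrite rho_bracket !(rho_push sK) /lieT; congr (_ + _).
Qed.

(** u and s (rho u) differ by an element of ker rho, which F annihilates. *)
Lemma curvature_horizontal p (u v : A p) :
  F p u v = F p (s p (anchor A p u)) (s p (anchor A p v)).
Proof.
have Bl (x y w : A p) : anchor A p (x - y) = 0 -> F p x w = F p y w.
  by move=> xy; rewrite -[x in LHS](subrK y) form2_Dl F0// add0r.
have k (x : A p) : anchor A p (x - s p (anchor A p x)) = 0.
  by rewrite linearB/= sK subrr.
rewrite (Bl u (s p (anchor A p u)))// form2_antisym.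
by rewrite (Bl v (s p (anchor A p v)))// -form2_antisym.
Qed.

(** The vertical parts u - s (rho u) and v - s (rho v) lie in ker rho, the image
    of rho^*, so they are orthogonal; expand their product, using that s is
    isotropic. *)
Lemma pair_decompose p (u v : A p) :
  apair u v = apair u (s p (anchor A p v)) + apair v (s p (anchor A p u)).
Proof.
have ker (x : A p) : anchor A p (x - s p (anchor A p x)) = 0.
  by rewrite linearB/= sK subrr.
have [al uE] := ker_anchor exA (ker u).
have := rhostarP vA al (v - s p (anchor A p v)).
rewrite -uE ker cotangent0 !(apairDl, apairDr, apairNl, apairNr) s_iso.
rewrite [apair (s p _) v]apair_sym => E.
have G (x y z : R) : x - y + (- z - - 0) = 0 -> x = y + z by lra.
exact: G E.
Qed.

Lemma to_standard_linear p :
  linear ((fun e => (anchor A p e, pair_form s e)) :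
    A p -> (tangent p * cotangent p)%type).
Proof. by move=> k u v; rewrite linearP pair_form_is_linear. Qed.

Definition to_standard : bundle_morphism A (dsum (TM M) (TstarM M)).
Proof.
exists (fun p => pack_linear (to_standard_linear (p := p))).
by move=> a; split; [exact: section_smooth (rho a)|exact: pair_form_smooth].
Defined.

Lemma from_standard_linear p :
  linear ((fun x => s p x.1 + rhostar A x.2) :
    (tangent p * cotangent p)%type -> A p).
Proof.
move=> k x y; rewrite /= linearP (rhostar_linear vA) scalerDr.
by rewrite addrACA.
Qed.

Definition from_standard : bundle_morphism (dsum (TM M) (TstarM M)) A.
Proof.
exists (fun p => pack_linear (from_standard_linear (p := p))).
move=> a; have := section_smooth (sig (dsum1 a) + rs (dsum2 a)).
congr smooth_section; apply: functional_extensionality_dep => q.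
by rewrite GammaDE.
Defined.

Lemma to_standardK p : cancel (to_standard p) (from_standard p).
Proof.
move=> e; rewrite -[LHS]/(s p (anchor A p e) + rhostar A (pair_form s e)).
apply: apair_ext => w; rewrite apairDl (rhostarP vA) /=.
by rewrite [apair e w]pair_decompose addrC; congr (_ + _); exact: apair_sym.
Qed.

Lemma from_standardK p : cancel (from_standard p) (to_standard p).
Proof.
move=> x; rewrite -[LHS]/(anchor A p (s p x.1 + rhostar A x.2),
  pair_form s (s p x.1 + rhostar A x.2)) [RHS]surjective_pairing.
congr (_, _); first by rewrite linearD/= sK anchor_rhostar// addr0.
apply: cotangentP => w.
by rewrite /= apairDl s_iso add0r (rhostarP vA) sK.
Qed.

(** H(X, Y, Z) = <[s X, s Y], s Z>. It is alternating because the bracket is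
    antisymmetric up to rho^* d <s X, s Y> = 0 and because X <s Y, s Z> = 0.
    Being tensorial in Z, it is then tensorial in every argument. *)
Lemma exists_flux : exists H : Omega3 M, forall X Y Z p,
  H p (X p) (Y p) (Z p) = ip (abracket (sig X) (sig Y)) (sig Z) p.
Proof.
apply: (form3_of_tensor vA sK
  (Phi := fun X Y Z => ip (abracket (sig X) (sig Y)) (sig Z))).
- move=> X Y Z; rewrite bracket_flip ip_sig ipDl ipNl ip_rstar.
  suff -> : pairing1 (d0 0) (rho (sig Z)) = 0 by rewrite add0r.
  by apply: CinfP => p; exact: tangent0.
- move=> X Y Z; apply/eqP; rewrite -addr_eq0 [X in _ + X]ipC -invA.
  by rewrite ip_sig act0.
move=> X Y f Z Z'; apply: CinfP => p.
rewrite /= linearP apairDr apairZr.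
by [].
Qed.

Definition coform (a : Gamma A) : Omega1 M := MkGamma (pair_form_smooth s a).

Lemma decompose a : a = sig (rho a) + rs (coform a).
Proof. by apply: GammaP => p; rewrite GammaDE -[LHS]to_standardK. Qed.

(** This lemma and the next two compute the brackets with at least one entry in the
    image of rho^*. By invariance of the pairing,
    <[a, rho^* be], c> = rho(a) be(rho c) - be(rho [a, c]),
    and rho [a, c] is known from the curvature; the two arguments are exchanged
    by [bracket_flip]. *)
Lemma ip_sig_rs X be Z :
  ip (abracket (sig X) (rs be)) (sig Z) = act X (pairing1 be Z) -
    pairing1 be (lieT torsion X Z).
Proof.
have := invA (sig X) (rs be) (sig Z).
rewrite !ip_rstar !(rho_push sK) rho_bracket_sig => ->.
by rewrite addrK.
Qed.

Lemma ip_rs_sig al Y Z :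
  ip (abracket (rs al) (sig Y)) (sig Z) = act Z (pairing1 al Y) -
    (act Y (pairing1 al Z) - pairing1 al (lieT torsion Y Z)).
Proof.
rewrite bracket_flip ipDl ipNl ip_sig_rs !ip_rstar !(rho_push sK).
by congr (_ - _); exact: CinfP.
Qed.

Lemma ip_rs_rs al be Z : ip (abracket (rs al) (rs be)) (sig Z) = 0.
Proof.
have := invA (rs al) (rs be) (sig Z).
rewrite (rho_rstar vA exA) !ip_rstar rho_bracket (rho_rstar vA exA).
have -> : form2_ev F (rs al) (sig Z) = 0.
  by apply: GammaP => p; rewrite /= F0// anchor_rhostar.
have a0 f : act (0 : Gamma (TM M)) f = 0 by exact: CinfP.
have -> : lie 0 (rho (sig Z)) = 0.
  by apply: vfP => f; rewrite lieE !a0 act0 subr0.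
rewrite a0 addr0.
have -> : pairing1 be 0 = 0 by apply: CinfP => p; exact: cotangent0.
by rewrite addr0 => <-.
Qed.

(** In (L^T_X be)(Z) the term d(be(X))(Z) cancels the term - Z(be(X)) of d be. *)
Lemma LieTE X be Z p :
  LieT torsion X be p (Z p) =
  (act X (pairing1 be Z) - pairing1 be (lieT torsion X Z)) p.
Proof.
rewrite /LieT GammaDE cotangentDE.
rewrite -[X in X + _]/(d1 be p (X p) (Z p) - be p (torsion p (X p) (Z p))).
rewrite (d1E vA sK) /d1_formula /lieT pairing1D.
have -> : dT0 torsion (pairing1 be X) = d0 (pairing1 be X).
  by rewrite /dT0 /iotaT0 subr0.
rewrite -[X in _ + X]/(act Z (pairing1 be X) p).
rewrite -[be p _]/(pairing1 be (form2_ev torsion X Z) p).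
rewrite !(CinfDE, CinfNE).
have E (x y z w : R) : x - y - z - w + y = x - (z + w) by ring.
exact: E.
Qed.

Lemma contract2E Y al Z p :
  contract2 Y (dT1 torsion al) p (Z p) =
  (act Y (pairing1 al Z) - act Z (pairing1 al Y) -
    pairing1 al (lieT torsion Y Z)) p.
Proof.
rewrite -[LHS]/(d1 al p (Y p) (Z p) - al p (torsion p (Y p) (Z p))).
rewrite (d1E vA sK) /d1_formula /lieT pairing1D.
rewrite -[al p _]/(pairing1 al (form2_ev torsion Y Z) p).
rewrite !(CinfDE, CinfNE).
have E (x y z w : R) : x - y - z - w = x - y - (z + w) by ring.
exact: E.
Qed.

(** The first components agree by [rho_bracket] and [curvature_horizontal]. The
    second ones are compared on Z after writing a = s X + rho^* al and
    b = s Y + rho^* be: the four brackets obtained give H(X, Y, Z),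
    (L^T_X be)(Z), - (i_Y d^T al)(Z) and 0. *)
Lemma standard_form : exists (T : Omega2TM M) (H : Omega3 M),
  algebroid_isomorphic A (standard_algebroid T H).
Proof.
have [H HE] := exists_flux.
exists torsion, H, to_standard; split.
- by exists from_standard => p; split; [exact: to_standardK|exact: from_standardK].
- by move=> p u v; rewrite [RHS]pair_decompose.
- by [].
move=> a b; apply: GammaP => p.
have d1a c : dsum1 (push to_standard c) = rho c by exact: GammaP.
have d2a c : dsum2 (push to_standard c) = coform c by exact: GammaP.
rewrite -[LHS]/(std_bracket torsion H (push to_standard a) (push to_standard b) p).
rewrite /std_bracket !d1a !d2a.
congr (_, _).
  rewrite -[RHS]/(rho (abracket a b) p) rho_bracket; congr (section _ p).
  congr (_ + _); apply: GammaP => q; exact/esym/curvature_horizontal.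
apply: cotangentP => v; have [Z <-] := extend_tangent vA sK v.
set X := rho a; set Y := rho b; set al := coform a; set be := coform b.
have split3 (x y z : Omega1 M) :
    (x - y + z) p (Z p) = x p (Z p) - y p (Z p) + z p (Z p).
  by rewrite !GammaDE GammaNE !cotangentDE cotangentNE.
apply: etrans (split3 _ _ _) _; rewrite LieTE contract2E.
rewrite -[contract3 _ _ _ _ _]/(H p (X p) (Y p) (Z p)) HE.
rewrite -[RHS]/(ip (abracket a b) (sig Z) p).
rewrite [in RHS](decompose a) [in RHS](decompose b) -/X -/Y -/al -/be.
rewrite bracketDl !bracketDr !ipDl ip_sig_rs ip_rs_sig ip_rs_rs.
rewrite !(CinfDE, CinfNE, Cinf0E).
set x1 := act X _ p; set x2 := pairing1 be _ p; set x3 := act Y _ p.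
set x4 := act Z _ p; set x5 := pairing1 al _ p; set x6 := ip _ _ p.
have E (y1 y2 y3 y4 y5 y6 : R) :
  y1 - y2 - (y3 - y4 - y5) + y6 = y6 + (y1 - y2) + (y4 - (y3 - y5) + 0) by ring.
exact: E.
Qed.

End StandardForm.

Theorem proposition3p6 (R : realType) (n : nat) (M : manifold R n)
    (A : algebroid M) :
  is_curved_Courant A -> is_exact A ->
  exists (T : Omega2TM M) (H : Omega3 M),
    algebroid_isomorphic A (standard_algebroid T H).
Proof.
move=> [[[r vA] bilA symA invA] [F [FE F0]]] exA.
have [s [sK s_iso]] := isotropic_splitting vA exA.
exact: (standard_form vA exA bilA symA invA FE F0 sK s_iso).
Qed.
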